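(* Let $\Gamma \curvearrowright A$ be an action with (SAveP) of a discrete group $\Gamma$ on a unital $C^*$-algebra $A$, and let $\Lambda$ be a subgroup of $\Gamma$ such that the (restricted) action $\Lambda \curvearrowright A$ is minimal. Then: (i) The inclusion $A \rtimes_r \Lambda \subseteq A \rtimes_r \Gamma$ is $C^*$-irreducible. (ii) If, moreover, $\Lambda$ is normal in $\Gamma$, then there is a bijective correspondence between intermediate $C^*$-algebras $A \rtimes_r \Lambda \subseteq D \subseteq A \rtimes_r \Gamma$ and intermediate subgroups $\Lambda \subseteq \Upsilon \subseteq \Gamma$ via $D = A \rtimes_r \Upsilon$.
   Context: For a unital $C^*$-algebra $A$ with unitary group $\mathcal{U}(A)$ and a $*$-automorphism $\beta$ on $A$, $\beta$ has the strong averaging property (SAveP) if for all $b \in A$, $0$ belongs to the norm closed convex hull of $\{v b \beta(v)^* : v \in \mathcal{U}(A)\}$. An action $\alpha$ of a discrete group $\Gamma$ on $A$ has (SAveP) if $\alpha_t$ has (SAveP) for all $t \in \Gamma$, $t \neq e$, where $e$ is the neutral element. An action on $A$ is minimal if the only invariant closed two-sided ideals of $A$ are $0$ and $A$. $A \rtimes_r \Gamma$ is the reduced crossed product; for a subgroup $\Upsilon$ of $\Gamma$, $A \rtimes_r \Upsilon$ is regarded as the sub-$C^*$-algebra of $A \rtimes_r \Gamma$ generated by $A$ and the canonical unitaries $u_t$, $t \in \Upsilon$. An inclusion $B \subseteq D$ of unital $C^*$-algebras is $C^*$-irreducible if all intermediate $C^*$-algebras (including $B$ and $D$) are simple. *)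

(* Defs.v *)
From HB Require Import structures.
From mathcomp Require Import all_boot all_order all_algebra.
From mathcomp Require Import complex.
From mathcomp Require Import all_classical all_reals all_analysis.

Set Implicit Arguments.
Unset Strict Implicit.
Unset Printing Implicit Defensive.
Import Order.TTheory GRing.Theory Num.Theory.
Import numFieldNormedType.Exports.
Local Open Scope classical_set_scope.
Local Open Scope ring_scope.

(* Unital C*-algebras over R[i], and nonzero ones since [GRing.Algebra] entails
   1 != 0.  The norm is a field of its own, with values in R, because
   Hierarchy-Builder refuses a structure that inherits both from rings and from
   the library's normed modules without being a numDomainType. *)
HB.mixin Record isCstarAlgebra (R : realType) A & GRing.Algebra R[i] A := {
  star : A -> A;
  starK : involutive star;
  starD : {morph star : x y / x + y};
  starZ : forall (c : R[i]) x, star (c *: x) = c^* *: star x;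
  starM : forall x y, star (x * y) = star y * star x;
  cnorm : A -> R;
  cnorm_eq0 : forall x, cnorm x = 0 -> x = 0;
  ler_cnormD : forall x y, cnorm (x + y) <= cnorm x + cnorm y;
  cnormZ : forall (c : R[i]) x, cnorm (c *: x) = complex.Re `|c| * cnorm x;
  ler_cnormM : forall x y, cnorm (x * y) <= cnorm x * cnorm y;
  cnorm_starM : forall x, cnorm (star x * x) = cnorm x ^+ 2;
  cnorm_complete : forall x_ : nat -> A,
    (forall e : R, 0 < e -> exists N, forall m n, (N <= m)%N -> (N <= n)%N ->
       cnorm (x_ m - x_ n) < e) ->
    exists l, cnorm (x_ n - l) @[n --> \oo] --> 0
}.

#[short(type="cstarAlgType")]
HB.structure Definition CstarAlgebra (R : realType) :=
  {A of isCstarAlgebra R A & GRing.Algebra R[i] A}.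

(* [inner] is linear in its first argument. *)
HB.mixin Record isHilbert (R : realType) H & CompleteNormedModule R[i] H := {
  inner : {dot H for Num.conj};
  inner_norm : forall x : H, inner x x = `|x| ^+ 2
}.

#[short(type="hilbertType")]
HB.structure Definition Hilbert (R : realType) :=
  {H of isHilbert R H & CompleteNormedModule R[i] H}.

Section Cstar.
Variables (R : realType) (A : cstarAlgType R).
Implicit Types S I D : set A.

Definition norm_closure S : set A :=
  [set x | forall e : R, 0 < e -> exists2 y, S y & cnorm (x - y) < e].

Definition norm_closed S := norm_closure S `<=` S.

Definition closed_convex_hull S : set A :=
  norm_closure (smallest (@convex_set R[i] A) S).

Definition unitary (v : A) := star v * v = 1 /\ v * star v = 1.

Definition SAveP (beta : A -> A) :=
  forall b : A,
    closed_convex_hull [set v * b * star (beta v) | v in unitary] 0.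

Definition cstar_subalgebra D :=
  [/\ D 0,
      forall (c : R[i]) x y, D x -> D y -> D (c *: x + y),
      forall x y, D x -> D y -> D (x * y),
      forall x, D x -> D (star x) &
      norm_closed D].

Definition closed_ideal D I :=
  [/\ I `<=` D,
      I 0,
      forall (c : R[i]) x y, I x -> I y -> I (c *: x + y),
      forall d x, D d -> I x -> I (d * x) /\ I (x * d) &
      norm_closed I].

Definition cstar_simple D :=
  D <> [set 0] /\ forall I, closed_ideal D I -> I = [set 0] \/ I = D.

(* [B `<=` D] is an inclusion of unital C*-subalgebras of the ambient algebra,
   with the ambient unit as common unit. *)
Definition cstar_irreducible (B D : set A) :=
  [/\ cstar_subalgebra B, cstar_subalgebra D, B 1, B `<=` D &
      forall E, cstar_subalgebra E -> B `<=` E -> E `<=` D -> cstar_simple E].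

End Cstar.

Section Groups.
Variable G : groupType.

Definition subgroup (S : set G) := group_closed [in S].

Definition normal_subgroup (S : set G) :=
  subgroup S /\ forall s t, S s -> S (t * s * t^-1)%g.

End Groups.

(* Each [act t] is bijective, with inverse [act t^-1]: it is a *-automorphism. *)
Record star_action (G : groupType) (R : realType) (A : cstarAlgType R) := {
  act :> G -> {lrmorphism A -> A};
  act_star : forall t a, act t (star a) = star (act t a);
  act1 : forall a, act 1%g a = a;
  actM : forall s t a, act (s * t)%g a = act s (act t a)
}.

Section Actions.
Variables (R : realType) (G : groupType) (A : cstarAlgType R).
Variable alpha : star_action G A.

Definition SAveP_action := forall t : G, t <> 1%g -> SAveP (alpha t).

Definition minimal_action (L : set G) :=
  forall I : set A, closed_ideal setT I ->
    (forall t, L t -> alpha t @` I `<=` I) -> I = [set 0] \/ I = setT.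

End Actions.

Record faithful_rep (R : realType) (A : cstarAlgType R) (H : hilbertType R) := {
  rep :> A -> {linear H -> H};
  rep_continuous : forall a, continuous (rep a);
  rep_linear : forall (c : R[i]) a b xi,
    rep (c *: a + b) xi = c *: rep a xi + rep b xi;
  rep1 : forall xi, rep 1 xi = xi;
  repM : forall a b xi, rep (a * b) xi = rep a (rep b xi);
  rep_star : forall a xi eta,
    inner (rep (star a) xi) eta = inner xi (rep a eta);
  rep_faithful : forall a, (forall xi, rep a xi = 0) -> a = 0
}.

Section ReducedCrossedProduct.
Variables (R : realType) (G : groupType) (A : cstarAlgType R).
Variables (alpha : star_action G A) (H : hilbertType R).
Variable rho : faithful_rep A H.

Definition finsupp_fun (f : G -> A) := finite_set [set t | f t <> 0].

(* The regular representation on l^2(G, H) of the formal sum of the f(t) u_t: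
   (a xi)(s) = rho (alpha_{s^-1} a) (xi s) and (u_t xi)(s) = xi (t^-1 s). *)
Definition regular_rep (f : G -> A) (xi : G -> H) (s : G) : H :=
  \sum_(t \in [set: G]) rho (alpha s^-1%g (f t)) (xi (t^-1 * s)%g).

Definition l2normsq (xi : G -> H) : \bar R :=
  \esum_(s in [set: G]) (complex.Re (inner (xi s) (xi s)))%:E.

(* Square of the operator norm of [regular_rep f] on l^2(G, H). *)
Definition reduced_normsq (f : G -> A) : \bar R :=
  ereal_sup [set l2normsq (regular_rep f xi) | xi in
    [set xi | (l2normsq xi <= 1)%E]].

(* [B] is the completion of the finitely supported functions from [G] to [A],
   written as sums of the a u_t, in the reduced norm. *)
Record reduced_crossed_product (B : cstarAlgType R) := {
  rcp_iota : {lrmorphism A -> B};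
  rcp_u : G -> B;
  rcp_iota_star : forall a, rcp_iota (star a) = star (rcp_iota a);
  rcp_unitary : forall t, unitary (rcp_u t);
  rcp_uM : forall s t, rcp_u (s * t)%g = rcp_u s * rcp_u t;
  rcp_covariant : forall t a,
    rcp_u t * rcp_iota a * star (rcp_u t) = rcp_iota (alpha t a);
  rcp_norm : forall f : G -> A, finsupp_fun f ->
    (cnorm (\sum_(t \in [set: G]) rcp_iota (f t) * rcp_u t) ^+ 2)%:E
      = reduced_normsq f;
  rcp_dense :
    norm_closure [set \sum_(t \in [set: G]) rcp_iota (f t) * rcp_u t |
                   f in finsupp_fun] = [set: B]
}.

Definition sub_crossed_product (B : cstarAlgType R)
    (P : reduced_crossed_product B) (U : set G) : set B :=
  smallest (@cstar_subalgebra R B) (range (rcp_iota P) `|` rcp_u P @` U).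

End ReducedCrossedProduct.

(* Main.v *)
Require Import Defs.
From HB Require Import structures.
From mathcomp Require Import all_boot all_order all_algebra.
From mathcomp Require Import complex.
From mathcomp Require Import all_classical all_reals all_analysis.
From mathcomp Require Import ring lra.

(** The proof compares an intermediate algebra [D] with [A] through the canonical
    conditional expectation [E] from the reduced crossed product onto [A], which
    reads off the coefficient at the neutral element.

    By (SAveP), for every [y] there is an average [phi] of conjugations by unitaries
    of [A] such that [phi (y - E y)] is small: approximate [y] by a finite sum and
    kill the terms [a u_t] with [t <> 1] one after the other
    ([averaging_to_cond_exp]). Suppose now that [M] is an [A]-bimodule inside the
    crossed product, stable under conjugation by [u_s] for [s] in [Lambda], and that
    [E] does not vanish on [M]. Then the closure of [E M] is a nonzero closed ideal
    of [A] invariant under [Lambda], so it contains [1] by minimality; choose [x] in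
    [M] with [E x] close to [1], and average [x]. The result is still in [M] and is
    close to [phi (E x)], hence to [1] ([bimodule_near1]).

    For a nonzero closed ideal [M] of [D], [E] does not vanish on [M] since [E] is
    faithful ([cond_exp_faithful]); so [M] contains [1], and [D] is simple. For
    [Lambda] normal, apply the same lemma to [M = D u_t^*] when some element of [D]
    has a nonzero coefficient at [t]; it gives [u_t] in [D]. Thus all elements of [D]
    have their coefficients supported in the subgroup [U] of those [t] with [u_t] in
    [D], and such elements belong to the crossed product by [U]
    ([scp_of_coef]), because there is a contractive map onto the latter which
    restricts the coefficients to [U].

    The analytic input concerns the reduced norm. Restriction of coefficients to a
    subgroup is contractive, since the regular representation of the restriction is
    the diagonal part of the original operator for the decomposition of the Hilbert
    space along the cosets ([window_restrict_le]); the trivial subgroup gives [E].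
    The norm of the crossed product only involves [rho], and one has to know that it
    induces the given norm on [A]: injective unital *-homomorphisms are isometric
    ([cnorm_smorph_inj]). That is derived from the existence and uniqueness of
    positive square roots, obtained by an explicit iteration ([sqrt_exists],
    [sqrt_uniq]). *)

Set Implicit Arguments.
Unset Strict Implicit.
Unset Printing Implicit Defensive.
Import Order.TTheory GRing.Theory Num.Theory.
Import numFieldNormedType.Exports.
Local Open Scope classical_set_scope.
Local Open Scope ring_scope.

(** * Elementary facts on C*-algebras *)

Lemma subrACA (V : zmodType) (x y z t : V) :
  (x - y) - (z - t) = (x - z) - (y - t).
Proof. by rewrite !opprB addrACA [RHS]addrACA [- y - z]addrC. Qed.

Section CstarBasics.
Variables (R : realType) (A : cstarAlgType R).
Implicit Types (x y z : A) (r e : R) (c : R[i]).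

Lemma Re_norm_real r : complex.Re `|r%:C%C| = `|r| :> R.
Proof. by rewrite normc_def /= expr0n /= addr0 sqrtr_sqr. Qed.

Lemma cnormZr r x : cnorm (r%:C%C *: x) = `|r| * cnorm x.
Proof. by rewrite cnormZ Re_norm_real. Qed.

Lemma cnorm0 : cnorm (0 : A) = 0.
Proof. by rewrite -(scale0r (0 : A)) cnormZ normr0 /= mul0r. Qed.

Lemma cnormN x : cnorm (- x) = cnorm x.
Proof. by rewrite -scaleN1r cnormZ normrN1 /= mul1r. Qed.

Lemma cnorm_ge0 x : 0 <= cnorm x.
Proof.
have := ler_cnormD x (- x); rewrite subrr cnorm0 cnormN; lra.
Qed.

Lemma cnorm_distC x y : cnorm (x - y) = cnorm (y - x).
Proof. by rewrite -opprB cnormN. Qed.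

Lemma cnormB_trans y x z : cnorm (x - z) <= cnorm (x - y) + cnorm (y - z).
Proof. by rewrite -{1}(subrK y x) -addrA; apply: ler_cnormD. Qed.

Lemma star0 : star (0 : A) = 0.
Proof. by apply: (addrI (star 0)); rewrite -starD !addr0. Qed.

Lemma starN x : star (- x) = - star x.
Proof. by apply/eqP; rewrite -addr_eq0 -starD addNr star0. Qed.

Lemma starB x y : star (x - y) = star x - star y.
Proof. by rewrite starD starN. Qed.

Lemma star1 : star (1 : A) = 1.
Proof. by rewrite -[LHS]mulr1 -{2}(starK 1) -starM mulr1 starK. Qed.

Lemma star_sum (I : Type) (s : seq I) (F : I -> A) :
  star (\sum_(i <- s) F i) = \sum_(i <- s) star (F i).
Proof. exact: (big_morph _ starD star0). Qed.

Lemma starZr r x : star (r%:C%C *: x) = r%:C%C *: star x.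
Proof. by rewrite starZ; congr (_ *: _); exact: conjc_real. Qed.

Lemma cnorm_star x : cnorm (star x) = cnorm x.
Proof.
suff H y : cnorm y <= cnorm (star y).
  by apply/eqP; rewrite eq_le H -{2}(starK x) H.
have := ler_cnormM (star y) y; rewrite cnorm_starM expr2.
have [->|y0] := eqVneq (cnorm y) 0; first by rewrite cnorm_ge0.
by rewrite ler_pM2r // lt_def y0 cnorm_ge0.
Qed.

Lemma cnorm1 : cnorm (1 : A) = 1.
Proof.
have := cnorm_starM (1 : A); rewrite star1 mulr1 => /eqP.
rewrite expr2 -{1}[cnorm 1]mulr1 -subr_eq0 -mulrBr mulf_eq0 subr_eq0 => /orP[/eqP/cnorm_eq0/eqP|/eqP//].
by rewrite oner_eq0.
Qed.

Lemma cnorm_unitary x : unitary x -> cnorm x = 1.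
Proof.
move=> [xx _]; have := cnorm_starM x; rewrite xx cnorm1 => /esym/eqP.
by rewrite sqrp_eq1 ?cnorm_ge0 // => /eqP.
Qed.

Lemma cnorm_sa x : star x = x -> cnorm (x * x) = cnorm x ^+ 2.
Proof. by move=> sx; rewrite -cnorm_starM sx. Qed.

Lemma cnorm_small x : (forall e, 0 < e -> cnorm x <= e) -> x = 0.
Proof.
move=> H; apply: cnorm_eq0; apply/eqP; rewrite eq_le cnorm_ge0 andbT.
by apply/ler_addgt0Pr => e e0; rewrite add0r; apply: H.
Qed.

Lemma unitary1 : unitary (1 : A).
Proof. by rewrite /unitary star1 mulr1. Qed.

Definition cnorm_cvg (x_ : nat -> A) l :=
  forall e, 0 < e -> exists N, forall n, (N <= n)%N -> cnorm (x_ n - l) < e.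

Lemma cnorm_cauchy_cvg (x_ : nat -> A) :
  (forall e, 0 < e -> exists N, forall m n, (N <= m)%N -> (N <= n)%N ->
     cnorm (x_ m - x_ n) < e) -> exists l, cnorm_cvg x_ l.
Proof.
move=> /cnorm_complete[l cl]; exists l => e e0.
have /cvgrPdist_lt/(_ e e0)[N _ HN] := cl; exists N => n Nn.
by have := HN n Nn; rewrite sub0r normrN ger0_norm ?cnorm_ge0.
Qed.

Lemma cnorm_cvg_uniq (x_ : nat -> A) l m :
  cnorm_cvg x_ l -> cnorm_cvg x_ m -> l = m.
Proof.
move=> xl xm; apply/eqP; rewrite -subr_eq0; apply/eqP/cnorm_small => e e0.
have [N HN] := xl _ (divr_gt0 e0 (ltr0n R 2)).
have [M HM] := xm _ (divr_gt0 e0 (ltr0n R 2)).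
have := HN _ (leq_maxl N M); have := HM _ (leq_maxr N M).
move=> h1 h2; have := cnormB_trans (x_ (maxn N M)) l m.
rewrite [cnorm (l - x_ _)]cnorm_distC; lra.
Qed.

Lemma cnorm_cvg_lip K (x_ : nat -> A) (f : A -> A) l :
  0 <= K -> (forall n, cnorm (f (x_ n) - f l) <= K * cnorm (x_ n - l)) ->
  cnorm_cvg x_ l -> cnorm_cvg (f \o x_) (f l).
Proof.
move=> K0 Hf xl e e0.
have K1 : 0 < K + 1 by lra.
have [N HN] := xl _ (divr_gt0 e0 K1); exists N => n /HN h.
rewrite /= (le_lt_trans (Hf n)) //.
have : (K+1) * cnorm (x_ n - l) < e by rewrite mulrC -ltr_pdivlMr.
have := cnorm_ge0 (x_ n - l); nra.
Qed.

Lemma cnorm_cvg_le (x_ : nat -> A) l K :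
  cnorm_cvg x_ l -> (forall n, cnorm (x_ n) <= K) -> cnorm l <= K.
Proof.
move=> xl H; apply/ler_addgt0Pr => e /xl[N /(_ N (leqnn _))].
have := cnormB_trans (x_ N) l 0; rewrite !subr0 cnorm_distC;
  have := H N;
lra.
Qed.

End CstarBasics.

(** * Square roots and isometry of injective *-homomorphisms *)

Section SquareRoot.
Variables (R : realType) (A : cstarAlgType R).
Implicit Types (x y z p s : A) (r e : R).

Fixpoint sqrt_iter z n : A :=
  if n is m.+1 then (2^-1)%:C%C *: (z + sqrt_iter z m * sqrt_iter z m) else 0.

(** The case [z = 1] of the iteration in the scalars; it dominates the norms. *)
Fixpoint sqrt_iter_bound n : R :=
  if n is m.+1 then 2^-1 * (1 + sqrt_iter_bound m * sqrt_iter_bound m) else 0.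

Lemma sqrt_iter_bound_itv n : 0 <= sqrt_iter_bound n <= 1.
Proof.
by elim: n => [|n /andP[IH1 IH2]] /=; first lra; apply/andP; split; nra.
Qed.

Lemma sqrt_iter_bound_incr n : sqrt_iter_bound n <= sqrt_iter_bound n.+1.
Proof. by have := sqrt_iter_bound_itv n; rewrite /=; nra. Qed.

Lemma sqrt_iter_le z n : cnorm z <= 1 ->
  cnorm (sqrt_iter z n) <= sqrt_iter_bound n /\
  cnorm (sqrt_iter z n.+1 - sqrt_iter z n)
    <= sqrt_iter_bound n.+1 - sqrt_iter_bound n.
Proof.
move=> z1.
have half : `|2^-1 : R| = 2^-1 by rewrite ger0_norm // invr_ge0.
elim: n => [|n [IH1 IH2]].
  rewrite /= cnorm0 !mulr0 !addr0 !subr0 cnormZr half; split => //.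
  by rewrite ler_pM2l // invr_gt0.
set w := sqrt_iter z in IH1 IH2 *; set q := sqrt_iter_bound in IH1 IH2 *.
have qn := sqrt_iter_bound_itv n; rewrite -/q in qn.
have w1 : cnorm (w n.+1) <= q n.+1.
  rewrite /w /q /= -/w -/q cnormZr half ler_pM2l ?invr_gt0 //.
  rewrite (le_trans (ler_cnormD _ _)) // lerD // (le_trans (ler_cnormM _ _)) //.
  by have := cnorm_ge0 (w n); nra.
split=> //.
have -> : w n.+2 - w n.+1 =
  (2^-1)%:C%C *: (w n.+1 * (w n.+1 - w n) + (w n.+1 - w n) * w n).
  rewrite mulrBr mulrBl addrA subrK {1}/w {2}/w /= -/w -/(w n.+1) -scalerBr.
  by rewrite opprD addrACA subrr add0r.
have -> : q n.+2 - q n.+1 =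
    2^-1 * (q n.+1 * (q n.+1 - q n) + (q n.+1 - q n) * q n).
  by rewrite {1}/q {2}/q /= -/q -/(q n.+1); ring.
rewrite cnormZr half ler_pM2l ?invr_gt0 //.
have g1 := cnorm_ge0 (w n); have g2 := cnorm_ge0 (w n.+1).
have g3 := cnorm_ge0 (w n.+1 - w n).
rewrite (le_trans (ler_cnormD _ _)) // lerD // (le_trans (ler_cnormM _ _)) //.
  exact: ler_pM.
exact: ler_pM.
Qed.

Lemma sqrt_iter_dist z m n : cnorm z <= 1 -> (n <= m)%N ->
  cnorm (sqrt_iter z m - sqrt_iter z n) <= sqrt_iter_bound m - sqrt_iter_bound n.
Proof.
move=> z1; elim: m => [|m IH]; first by rewrite leqn0 => /eqP ->; rewrite !subrr cnorm0.
rewrite leq_eqVlt => /orP[/eqP ->|]; first by rewrite !subrr cnorm0.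
rewrite ltnS => /IH h.
rewrite (le_trans (cnormB_trans (sqrt_iter z m) _ _)) //.
by have [_] := sqrt_iter_le m z1; lra.
Qed.

Lemma sqrt_iter_bound_cauchy e : 0 < e ->
  exists N, forall m n, (N <= n)%N -> sqrt_iter_bound m - sqrt_iter_bound n < e.
Proof.
move=> e0; set S := range sqrt_iter_bound.
have hS : has_sup S.
  split; first by exists 0; exists 0%N.
  by exists 1 => _ [n _ <-]; case/andP: (sqrt_iter_bound_itv n).
have [_ [N _ <-] HN] := sup_adherent e0 hS.
exists N => m n Nn.
have h1 : sqrt_iter_bound m <= sup S.
  by apply: sup_upper_bound => //; exists m.
have h2 : sqrt_iter_bound N <= sqrt_iter_bound n.
  by apply: (homo_leq (r := <=%O)) Nn => //;
    [exact: le_trans | exact: sqrt_iter_bound_incr].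
lra.
Qed.

Lemma sqrt_iter_cvg z : cnorm z <= 1 -> exists w, cnorm_cvg (sqrt_iter z) w.
Proof.
move=> z1; apply: cnorm_cauchy_cvg => e e0.
have [N HN] := sqrt_iter_bound_cauchy e0; exists N => m n.
wlog nm : m n / (n <= m)%N => [H Nm Nn|Nm Nn].
  by case/orP: (leq_total n m) => h; [|rewrite cnorm_distC]; apply: H.
by rewrite (le_lt_trans (sqrt_iter_dist z1 nm)) // HN.
Qed.

Lemma cnorm_cvg_shift (x_ : nat -> A) l :
  cnorm_cvg x_ l -> cnorm_cvg (fun n => x_ n.+1) l.
Proof. by move=> xl e /xl[N HN]; exists N => n Nn; apply/HN/leqW. Qed.

(** The iteration [w := (z + w ^ 2) / 2] at [z = 1 - p] has increments that are
    polynomials in [z] with nonnegative coefficients, so it is dominated by its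
    scalar version at [1], which is bounded by [1]. Its limit satisfies
    [(1 - w) ^ 2 = 1 - z = p]. The boundary case [cnorm (1 - p) = 1] is covered,
    which is what makes absolute values available below. *)
Lemma sqrt_exists p : star p = p -> cnorm (1 - p) <= 1 ->
  exists s, [/\ star s = s, s * s = p, cnorm (1 - s) <= 1 &
                forall x, x * p = p * x -> x * s = s * x].
Proof.
move=> sp p1; set z := 1 - p in p1.
have [w cw] := sqrt_iter_cvg p1.
have wb n : cnorm (sqrt_iter z n) <= 1.
  have [h _] := sqrt_iter_le n p1.
  by rewrite (le_trans h) //; case/andP: (sqrt_iter_bound_itv n).
have w1 : cnorm w <= 1 by exact: cnorm_cvg_le cw wb.
have ww : w = (2^-1)%:C%C *: (z + w * w).
  apply: (cnorm_cvg_uniq (cnorm_cvg_shift cw)).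
  apply: (cnorm_cvg_lip (K := 1) (f := fun w => (2^-1)%:C%C *: (z + w * w))
    _ _ cw) => // n.
  rewrite -scalerBr opprD addrACA subrr add0r cnormZr ger0_norm ?invr_ge0 //.
  set v := sqrt_iter z n.
  have -> : v * v - w * w = v * (v - w) + (v - w) * w.
    by rewrite mulrBr mulrBl addrA subrK.
  have h1 := ler_cnormD (v * (v - w)) ((v - w) * w).
  have h2 := ler_cnormM v (v - w); have h3 := ler_cnormM (v - w) w.
  by have := cnorm_ge0 (v - w); have := wb n; rewrite -/v; nra.
(* A bounded additive condition met by all iterates passes to the limit. *)
have lim_fix (f : A -> A) : (forall x y, f (x - y) = f x - f y) ->
    (exists2 K, 0 <= K & forall x, cnorm (f x) <= K * cnorm x) ->
    (forall n, f (sqrt_iter z n) = 0) -> f w = 0.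
  move=> fB [K K0 fK] f0.
  have c1 := cnorm_cvg_lip (f := f) K0 _ cw.
  apply: (cnorm_cvg_uniq (c1 _)) => [n|]; first by rewrite -fB fK.
  by move=> e e0; exists 0%N => n _ /=; rewrite f0 subrr cnorm0.
have sz : star z = z by rewrite starB star1 sp.
have sw : star w = w.
  apply/eqP; rewrite -subr_eq0; apply/eqP.
  apply: (lim_fix (fun w => star w - w)).
  - by move=> x y; rewrite starB subrACA.
  - exists 2 => // x; rewrite (le_trans (ler_cnormD _ _)) // cnormN cnorm_star; lra.
  - elim=> [|n /eqP]; first by rewrite star0 subrr.
    rewrite subr_eq0 => /eqP IH; rewrite /= starZr starD starM sz IH.
    by rewrite subrr.
exists (1 - w); split.
- by rewrite starB star1 sw.
- rewrite mulrBl mul1r mulrBr mulr1.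
  have -> : p = 1 - z by rewrite opprB addrC subrK.
  have -> : z = w + w - w * w.
    rewrite {1 2}ww -scalerDl -rmorphD /=.
    have -> : 2^-1 + 2^-1 = 1 :> R by lra.
    by rewrite -[(1%:C)%C]/(1 : R[i]) scale1r addrK.
  by rewrite !opprD !opprK !addrA.
- by rewrite opprB addrC subrK.
- move=> x xp; rewrite mulrBl mulrBr mul1r mulr1; congr (_ - _).
  apply/eqP; rewrite -subr_eq0; apply/eqP.
  apply: (lim_fix (fun w => x * w - w * x)).
  - by move=> a b; rewrite mulrBr mulrBl subrACA.
  - exists (2 * cnorm x); first by rewrite mulr_ge0 // cnorm_ge0.
    move=> a; rewrite (le_trans (ler_cnormD _ _)) // cnormN.
    have := ler_cnormM x a; have := ler_cnormM a x; nra.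
  - elim=> [|n /eqP]; first by rewrite mulr0 mul0r subrr.
    rewrite subr_eq0 => /eqP IH; rewrite /= -scalerAr -scalerAl mulrDr mulrDl.
    have -> : x * z = z * x by rewrite /z mulrBl mulrBr mul1r mulr1 xp.
    by rewrite -mulrA -IH !mulrA -IH subrr.
Qed.

End SquareRoot.

Section SelfAdjoint.
Variables (R : realType) (A : cstarAlgType R).
Implicit Types (x y p s : A) (r : R).

(** The element [u = x + i y] satisfies [star u * u = r ^ 2], and [x] is its
    real part. *)
Lemma cnorm_le_of_sum_squares x y r : 0 <= r ->
  star x = x -> star y = y -> x * y = y * x ->
  x * x + y * y = (r ^+ 2)%:C%C *: 1 -> cnorm x <= r.
Proof.
move=> r0 sx sy xy H.
set u := x + 'i%C *: y.
have su : star u = x - 'i%C *: y.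
  rewrite starD starZ sx sy -scaleNr; congr (_ + _ *: _).
  by apply/eqP; rewrite eq_complex /= oppr0 !eqxx.
have uu : star u * u = (r ^+ 2)%:C%C *: 1.
  have e1 : x * ('i%C *: y) = 'i%C *: (x * y) by rewrite -scalerAr.
  have e2 : ('i%C *: y) * x = 'i%C *: (x * y) by rewrite -scalerAl xy.
  have e3 : ('i%C *: y) * ('i%C *: y) = - (y * y).
    by rewrite -scalerAl -scalerAr scalerA -expr2 sqr_i scaleN1r.
  by rewrite -H su mulrBl !mulrDr e1 e2 e3 opprD opprK addrA addrK.
have nu : cnorm u = r.
  have := cnorm_starM u; rewrite uu cnormZr cnorm1 mulr1 ger0_norm ?sqr_ge0 //.
  by move=> /eqP; rewrite eqrXn2 ?cnorm_ge0 // => /eqP.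
have : cnorm (2%:C%C *: x) <= 2 * r.
  have -> : 2%:C%C *: x = u + star u.
    rewrite su addrACA subrr addr0 -{2 3}(scale1r x) -scalerDl.
    by congr (_ *: _); rewrite -[1 : R[i]]/(1%:C)%C -rmorphD.
  by rewrite (le_trans (ler_cnormD _ _)) // cnorm_star nu; lra.
by rewrite cnormZr ger0_norm // ler_pM2l.
Qed.

(** With [y ^ 2 = 1 - x ^ 2], the element [x + i y] is unitary, so [y] is a
    contraction. *)
Lemma cnorm_1Bsqr_le1 x : star x = x -> cnorm x <= 1 -> cnorm (1 - x * x) <= 1.
Proof.
move=> sx x1.
have sp : star (1 - x * x) = 1 - x * x by rewrite starB star1 starM sx.
have [|y [sy yy _ cy]] := sqrt_exists sp.
  rewrite opprB addrC subrK (le_trans (ler_cnormM _ _)) //.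
  by have := cnorm_ge0 x; nra.
have xy : x * y = y * x.
  by apply: cy; rewrite mulrBl mulrBr mul1r mulr1 mulrA.
have : cnorm y <= 1.
  apply: (@cnorm_le_of_sum_squares y x) => //.
  by rewrite yy subrK expr1n scale1r.
by rewrite -yy cnorm_sa //; have := cnorm_ge0 y; nra.
Qed.

(** With [d = p - s], [g ^ 2 = p] and [h ^ 2 = s], the self-adjoint elements
    [g d] and [h d] have squares adding up to [(p ^ 2 - s ^ 2) d = 0]. *)
Lemma sqrt_uniq p s : star p = p -> star s = s ->
  cnorm (1 - p) <= 1 -> cnorm (1 - s) <= 1 -> p * s = s * p ->
  p * p = s * s -> p = s.
Proof.
move=> sp ss p1 s1 ps pp.
have [g [sg gg _ cg]] := sqrt_exists sp p1.
have [h [sh hh _ ch]] := sqrt_exists ss s1.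
set d := p - s.
have sd : star d = d by rewrite starB sp ss.
have dp : d * p = p * d by rewrite mulrBl mulrBr ps.
have ds : d * s = s * d by rewrite mulrBl mulrBr ps.
have dg : d * g = g * d by exact: cg.
have dh : d * h = h * d by exact: ch.
have gh : g * h = h * g by apply: ch; rewrite -cg.
have sX : star (g * d) = g * d by rewrite starM sg sd.
have sY : star (h * d) = h * d by rewrite starM sh sd.
have XX : (g * d) * (g * d) = p * d * d.
  by rewrite -gg -mulrA [d * _]mulrA dg !mulrA.
have YY : (h * d) * (h * d) = s * d * d.
  by rewrite -hh -mulrA [d * _]mulrA dh !mulrA.
have XY : (g * d) * (h * d) = (h * d) * (g * d).
  by rewrite -mulrA [d * _]mulrA dh -[RHS]mulrA [d * (g * _)]mulrA dg !mulrA gh.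
have XXYY : (g * d) * (g * d) + (h * d) * (h * d) = (0 ^+ 2)%:C%C *: 1.
  rewrite XX YY -mulrDl -mulrDl expr0n /= scale0r.
  suff -> : (p + s) * d = 0 by rewrite mul0r.
  by rewrite /d mulrDl !mulrBr pp ps addrA subrK subrr.
have X0 : g * d = 0.
  apply: cnorm_eq0; apply/eqP; rewrite eq_le cnorm_ge0 andbT.
  exact: cnorm_le_of_sum_squares XXYY.
have Y0 : h * d = 0.
  apply: cnorm_eq0; apply/eqP; rewrite eq_le cnorm_ge0 andbT.
  by apply: cnorm_le_of_sum_squares sY sX _ _; rewrite // addrC.
apply/eqP; rewrite -subr_eq0 -/d; apply/eqP/cnorm_eq0/eqP.
rewrite -(@sqrf_eq0 R) -cnorm_sa // {1}/d mulrBl -gg -hh -!mulrA X0 Y0.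
by rewrite !mulr0 subrr cnorm0.
Qed.

End SelfAdjoint.

Section StarMorphisms.
Variables (R : realType) (A B : cstarAlgType R).
Variable f : {lrmorphism A -> B}.
Hypothesis f_star : forall a, f (star a) = star (f a).

Lemma cnorm_smorph_sa a : star a = a -> cnorm (f a) <= cnorm a.
Proof.
have H b : star b = b -> cnorm b <= 1 -> cnorm (f b) <= 1.
  move=> sb b1.
  have sp : star (1 - b * b) = 1 - b * b by rewrite starB star1 starM sb.
  have [|y [sy yy _ cy]] := sqrt_exists sp.
    rewrite opprB addrC subrK (le_trans (ler_cnormM _ _)) //.
    by have := cnorm_ge0 b; nra.
  have xy : b * y = y * b.
    by apply: cy; rewrite mulrBl mulrBr mul1r mulr1 mulrA.
  apply: (@cnorm_le_of_sum_squares _ _ (f b) (f y)) => //.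
  - by rewrite -f_star sb.
  - by rewrite -f_star sy.
  - by rewrite -!rmorphM xy.
  - by rewrite -!rmorphM -rmorphD yy addrC subrK rmorph1 expr1n scale1r.
move=> sa; have [a0|a0] := eqVneq (cnorm a) 0.
  by rewrite (cnorm_eq0 _ a0) rmorph0 !cnorm0.
have a_gt0 : 0 < cnorm a by rewrite lt_def a0 cnorm_ge0.
have := H ((cnorm a)^-1%:C%C *: a).
rewrite starZr sa linearZ /= !cnormZr ger0_norm ?invr_ge0 ?cnorm_ge0 //.
rewrite mulVf // => /(_ erefl (lexx _)).
by rewrite mulrC ler_pdivrMr // mul1r.
Qed.

(** For self-adjoint [a] of norm at most one there is a self-adjoint [y] with
    [a ^ 2 + y ^ 2 = 1]; the morphism preserves this relation, which bounds the norm
    of the image of [a]. The general case follows by the C*-identity. *)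
Lemma cnorm_smorph a : cnorm (f a) <= cnorm a.
Proof.
rewrite -(@ler_pXn2r _ 2) ?nnegrE ?cnorm_ge0 // -!cnorm_starM -f_star -rmorphM.
by apply: cnorm_smorph_sa; rewrite starM starK.
Qed.

Hypothesis f_inj : forall a, f a = 0 -> a = 0.

(** Let [c] be self-adjoint of norm one with [eps = cnorm (f c) ^ 2 < 1], and
    [a = c ^ 2]. The absolute value of [a - eps] is sent to that of
    [f a - eps], which is [eps - f a]. Injectivity gives [|a - eps| = eps - a],
    so that [eps = c ^ 2 + g ^ 2] with [g] a square root of [eps - a], and this
    contradicts [cnorm c = 1]. *)
Lemma cnorm_smorph_inj_sa c : star c = c -> cnorm c = 1 -> 1 <= cnorm (f c).
Proof.
move=> sc c1; rewrite leNgt; apply/negP => fc1.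
set e := cnorm (f c) ^+ 2; set a := c * c.
have fc0 := cnorm_ge0 (f c).
have e0 : 0 <= e by exact: sqr_ge0.
have e1 : e < 1 by rewrite /e expr2; nra.
have sa : star a = a by rewrite starM sc.
have a1 : cnorm a = 1 by rewrite cnorm_sa // c1 expr1n.
have fa : cnorm (f a) = e.
  by rewrite rmorphM cnorm_sa // -f_star sc.
pose E (C : cstarAlgType R) : C := e%:C%C *: 1.
have sE C : star (E C) = E C by rewrite /E starZr star1.
have EC C y : y * E C = E C * y.
  by rewrite /E -scalerAr -scalerAl mulr1 mul1r.
set x := a - E A.
have sx : star x = x by rewrite /x starB sa sE.
have x1 : cnorm x <= 1.
  have -> : x = (1 - e)%:C%C *: a - e%:C%C *: (1 - a).
    rewrite scalerBr opprB addrA -scalerDl -rmorphD /= subrK /x /E.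
    by rewrite -[(1%:C)%C]/(1 : R[i]) scale1r.
  rewrite (le_trans (ler_cnormD _ _)) // cnormN !cnormZr a1 !ger0_norm //; last lra.
  have := @cnorm_1Bsqr_le1 _ _ c sc; rewrite c1 => /(_ (lexx _)).
  by rewrite -/a; have := cnorm_ge0 (1 - a); nra.
have [] := @sqrt_exists _ _ (x * x) _ (cnorm_1Bsqr_le1 sx x1).
  by rewrite starM sx.
move=> s [ss sxx s1 cs].
have asC : a * s = s * a.
  apply: cs; have ax : a * x = x * a by rewrite /x mulrBl mulrBr EC.
  by rewrite mulrA ax -mulrA ax mulrA.
have fs : f s = f (E A - a).
  have fE : f (E A - a) = E B - f a by rewrite rmorphB /E /= linearZ /= rmorph1.
  apply: sqrt_uniq.
  - by rewrite -f_star ss.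
  - by rewrite fE starB sE -f_star sa.
  - by rewrite -(rmorph1 f) -rmorphB (le_trans (cnorm_smorph _)).
  - rewrite fE opprB addrCA -{1}(scale1r (1 : B)) -[1 : R[i]]/(1%:C)%C.
    rewrite -scalerBl -rmorphB (le_trans (ler_cnormD _ _)) // cnormZr cnorm1 fa.
    by rewrite ger0_norm; lra.
  - by rewrite -!rmorphM mulrBl mulrBr EC asC.
  - by rewrite -!rmorphM sxx -(opprB a) mulrNN.
have {fs} sE' : s = E A - a.
  apply/eqP; rewrite -subr_eq0; apply/eqP/f_inj.
  by apply/eqP; rewrite rmorphB subr_eq0; apply/eqP; exact: fs.
have [g [sg gg _ cg]] := sqrt_exists ss s1.
have : cnorm c <= cnorm (f c).
  apply: (@cnorm_le_of_sum_squares _ _ c g) => //.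
  - by apply: cg; rewrite sE' mulrBl mulrBr EC /a mulrA.
  - by rewrite gg sE' -/a addrC subrK.
by rewrite c1; lra.
Qed.

Lemma cnorm_smorph_inj a : cnorm (f a) = cnorm a.
Proof.
apply/eqP; rewrite eq_le cnorm_smorph /=.
rewrite -(@ler_pXn2r _ 2) ?nnegrE ?cnorm_ge0 // -!cnorm_starM -f_star -rmorphM.
set c := star a * a; have sc : star c = c by rewrite starM starK.
have [c0|c0] := eqVneq (cnorm c) 0; first by rewrite c0 cnorm_ge0.
have c_gt0 : 0 < cnorm c by rewrite lt_def c0 cnorm_ge0.
have := @cnorm_smorph_inj_sa ((cnorm c)^-1%:C%C *: c).
rewrite starZr sc linearZ /= !cnormZr ger0_norm ?invr_ge0 ?cnorm_ge0 //.
by rewrite mulVf // => /(_ erefl erefl); rewrite mulrC ler_pdivlMr // mul1r.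
Qed.

End StarMorphisms.

(** * The norm of a Hilbert space *)

Section HilbertNorm.
Variables (R : realType) (H : hilbertType R).
Implicit Types (x y : H) (r : R).

Definition hnorm x : R := complex.Re `|x|.

Lemma hnormE x : `|x| = (hnorm x)%:C%C.
Proof.
have := normr_ge0 x; rewrite /hnorm; case: `|x| => a b.
by rewrite lecE /= => /andP[/eqP -> _].
Qed.

Lemma Re_inner x : complex.Re (inner x x) = hnorm x ^+ 2.
Proof. by rewrite inner_norm hnormE -rmorphXn. Qed.

Lemma hnorm_ge0 x : 0 <= hnorm x.
Proof. by have := normr_ge0 x; rewrite hnormE lecR. Qed.

Lemma hnorm0 : hnorm 0 = 0.
Proof. by rewrite /hnorm normr0. Qed.

Lemma hnormZ r x : hnorm (r%:C%C *: x) = `|r| * hnorm x.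
Proof. by rewrite {1}/hnorm normrZ hnormE [`|r%:C%C|]normc_def /= expr0n /= addr0 sqrtr_sqr mulr0 subr0. Qed.

Lemma hnorm_eq0 x : hnorm x = 0 -> x = 0.
Proof. by move=> x0; apply/eqP; rewrite -normr_eq0 hnormE x0. Qed.

Lemma ler_hnormD x y : hnorm (x + y) <= hnorm x + hnorm y.
Proof. by have := ler_normD x y; rewrite !hnormE -rmorphD lecR. Qed.

Lemma hnormN x : hnorm (- x) = hnorm x.
Proof. by rewrite /hnorm normrN. Qed.

Lemma hnorm_sum (I : Type) (s : seq I) (F : I -> H) :
  hnorm (\sum_(i <- s) F i) <= \sum_(i <- s) hnorm (F i).
Proof.
elim: s => [|i s IH]; first by rewrite !big_nil hnorm0.
by rewrite !big_cons (le_trans (ler_hnormD _ _)) // lerD2l.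
Qed.

Lemma hnorm_sqrD x y : hnorm (x + y) ^+ 2 <= 2 * hnorm x ^+ 2 + 2 * hnorm y ^+ 2.
Proof.
have px := hnorm_ge0 x; have py := hnorm_ge0 y.
apply: (@le_trans _ _ ((hnorm x + hnorm y) ^+ 2)).
  by rewrite ler_pXn2r ?nnegrE ?addr_ge0 ?hnorm_ge0 // ler_hnormD.
by have := sqr_ge0 (hnorm x - hnorm y); rewrite !expr2; nra.
Qed.

(** A weak form of the Cauchy-Schwarz inequality, from polarization. *)
Lemma Re_inner_le x y :
  complex.Re (inner x y) <= hnorm x * (hnorm x + hnorm y).
Proof.
have : complex.Re (inner (x + y) (x + y)) - complex.Re (inner (x - y) (x - y))
    = 4 * complex.Re (inner x y).
  rewrite dnormD dnormB; case: (inner x y) => a b.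
  by case: (inner x x) => c d; case: (inner y y) => u v /=; ring.
rewrite !Re_inner.
have h1 := ler_hnormD x y.
have h3 := ler_hnormD x (- y); rewrite hnormN in h3.
have h5 := ler_hnormD (- (x - y)) (2%:C%C *: x).
have e5 : - (x - y) + 2%:C%C *: x = x + y.
  have -> : 2%:C%C *: x = x + x.
    by rewrite -{2 3}(scale1r x) -scalerDl -[1 : R[i]]/(1%:C)%C -rmorphD.
  by rewrite opprB addrA subrK addrC.
rewrite e5 hnormN hnormZ ger0_norm // in h5.
have p1 := hnorm_ge0 x; have p2 := hnorm_ge0 y.
have p3 := hnorm_ge0 (x + y); have p4 := hnorm_ge0 (x - y).
have h6 : (hnorm (x + y) - hnorm (x - y)) * (hnorm (x + y) + hnorm (x - y))
    <= (2 * hnorm x) * (2 * (hnorm x + hnorm y)).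
  rewrite (@le_trans _ _ ((2 * hnorm x) * (hnorm (x + y) + hnorm (x - y)))) //.
    by rewrite ler_wpM2r ?addr_ge0 //; lra.
  by rewrite ler_wpM2l; lra.
by rewrite !expr2; nra.
Qed.

End HilbertNorm.

(** * The regular representation on finite windows *)

Section FiniteSupport.
Variables (R : realType) (G : groupType) (A : cstarAlgType R).
Implicit Types (f g : G -> A) (T F : seq G).

Lemma fsum_seq (V : nmodType) T (h : G -> V) : uniq T ->
  (forall t, t \notin T -> h t = 0) ->
  \sum_(t \in [set: G]) h t = \sum_(t <- T) h t.
Proof.
move=> uT hT; rewrite (fsbigE T) // => [|t _]; last exact: hT.
by apply: eq_bigl => t; rewrite in_setT.
Qed.

Lemma finsuppP f : finsupp_fun f <->
  exists2 T, uniq T & forall t, t \notin T -> f t = 0.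
Proof.
split=> [/finite_seqP[T fT]|[T _ fT]].
  exists (undup T); first exact: undup_uniq.
  move=> t; rewrite mem_undup => tT; apply: contrapT => ft.
  by move/negP: tT; apply; have : [set` T] t by rewrite -fT.
apply: (@sub_finite_set _ _ [set` T]) => // t /= ft.
by apply: contrapT => /negP/fT.
Qed.

Lemma finsupp_sub f g : finsupp_fun f -> finsupp_fun g ->
  finsupp_fun (fun t => f t - g t).
Proof.
move=> /finsuppP[T _ fT] /finsuppP[F _ gF]; apply/finsuppP.
exists (undup (T ++ F)); first exact: undup_uniq.
by move=> t; rewrite mem_undup mem_cat negb_or => /andP[/fT -> /gF ->]; rewrite subrr.
Qed.

Lemma finsupp_add f g : finsupp_fun f -> finsupp_fun g ->
  finsupp_fun (fun t => f t + g t).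
Proof.
move=> /finsuppP[T _ fT] /finsuppP[F _ gF]; apply/finsuppP.
exists (undup (T ++ F)); first exact: undup_uniq.
by move=> t; rewrite mem_undup mem_cat negb_or => /andP[/fT -> /gF ->]; rewrite addr0.
Qed.

Lemma finsupp0 : finsupp_fun ((fun=> 0) : G -> A).
Proof. by apply/finsuppP; exists [::]. Qed.

Definition restrict (U : set G) f : G -> A := fun t => if t \in U then f t else 0.

Lemma finsupp_restrict U f : finsupp_fun f -> finsupp_fun (restrict U f).
Proof.
move=> /finsuppP[T uT fT]; apply/finsuppP; exists T => // t /fT ft.
by rewrite /restrict ft if_same.
Qed.

(** The coefficients of the monomial [a u_s]. *)
Definition single (s : G) (a : A) : G -> A := fun t => if t == s then a else 0.

Lemma finsupp_single s a : finsupp_fun (single s a).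
Proof.
apply/finsuppP; exists [:: s] => // t.
by rewrite inE /single => /negbTE ->.
Qed.

End FiniteSupport.

Lemma cnorm_act (R : realType) (G : groupType) (A : cstarAlgType R)
    (alpha : star_action G A) t a : cnorm (alpha t a) = cnorm a.
Proof.
apply: (cnorm_smorph_inj (act_star alpha t)) => b b0.
by rewrite -(act1 alpha b) -(mulVg t) actM b0 raddf0.
Qed.

Section RegularRepresentation.
Variables (R : realType) (G : groupType) (A : cstarAlgType R).
Variables (alpha : star_action G A) (H : hilbertType R) (rho : faithful_rep A H).
Implicit Types (f g : G -> A) (xi : G -> H) (T F W : seq G).

Lemma rho_add a b h : rho (a + b) h = rho a h + rho b h.
Proof. by have := rep_linear rho 1 a b h; rewrite !scale1r. Qed.

Lemma rho_0 h : rho 0 h = 0.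
Proof. by apply: (addrI (rho 0 h)); rewrite -rho_add !addr0. Qed.

Lemma rho_opp a h : rho (- a) h = - rho a h.
Proof. by apply/eqP; rewrite -addr_eq0 -rho_add addNr rho_0. Qed.

Lemma rho_sum (I : Type) (s : seq I) (F : I -> A) h :
  rho (\sum_(i <- s) F i) h = \sum_(i <- s) rho (F i) h.
Proof.
by apply: (big_morph (fun a => rho a h)) => [a b|]; [exact: rho_add|exact: rho_0].
Qed.

Lemma regular_repE f xi s T : uniq T -> (forall t, t \notin T -> f t = 0) ->
  regular_rep alpha rho f xi s =
    \sum_(t <- T) rho (alpha s^-1%g (f t)) (xi (t^-1 * s)%g).
Proof.
move=> uT fT; apply: fsum_seq => // t /fT ->; by rewrite raddf0 rho_0.
Qed.

Lemma regular_repZ f (c : R[i]) xi s : finsupp_fun f ->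
  regular_rep alpha rho f (fun t => c *: xi t) s = c *: regular_rep alpha rho f xi s.
Proof.
move=> /finsuppP[T uT fT]; rewrite !(regular_repE _ _ uT fT) scaler_sumr.
by apply: eq_bigr => t _; rewrite linearZ.
Qed.

Lemma regular_repB f g xi s : finsupp_fun f -> finsupp_fun g ->
  regular_rep alpha rho (fun t => f t - g t) xi s =
  regular_rep alpha rho f xi s - regular_rep alpha rho g xi s.
Proof.
move=> /finsuppP[T _ fT] /finsuppP[F _ gF].
have uTF : uniq (undup (T ++ F)) by exact: undup_uniq.
have fTF t : t \notin undup (T ++ F) -> f t = 0.
  by rewrite mem_undup mem_cat negb_or => /andP[/fT].
have gTF t : t \notin undup (T ++ F) -> g t = 0.
  by rewrite mem_undup mem_cat negb_or => /andP[_ /gF].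
rewrite (regular_repE _ _ uTF fTF) (regular_repE _ _ uTF gTF).
rewrite (regular_repE _ _ uTF) => [|t tn]; last by rewrite fTF // gTF // subrr.
rewrite -sumrB; apply: eq_bigr => t _.
by rewrite raddfB rho_add rho_opp.
Qed.

Definition window_normsq xi W := \sum_(s <- W) hnorm (xi s) ^+ 2.

Lemma window_normsq_ge0 xi W : 0 <= window_normsq xi W.
Proof. by apply: sumr_ge0 => s _; exact: sqr_ge0. Qed.

Lemma window_le_l2normsq xi W : uniq W ->
  ((window_normsq xi W)%:E <= l2normsq xi)%E.
Proof.
move=> uW; apply: esum_ge; exists [set` W]; first by split=> //; exact: finite_seq.
rewrite -fsbig_seq // /window_normsq -sumEFin.
by under [X in (_ <= X)%E]eq_bigr do rewrite Re_inner.
Qed.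

Lemma l2normsq_window xi W : uniq W -> (forall s, s \notin W -> xi s = 0) ->
  l2normsq xi = (window_normsq xi W)%:E.
Proof.
move=> uW xiW; rewrite /l2normsq (esumID [set` W]) /=; last first.
  by move=> s _; rewrite lee_fin Re_inner sqr_ge0.
rewrite [X in (_ + X)%E]esum1 ?adde0; last first.
  by move=> s [_ /= /negP sW]; rewrite Re_inner xiW // hnorm0 expr0n.
rewrite setTI esum_fset; [|exact: finite_seq|]; last by move=> s _; rewrite lee_fin Re_inner sqr_ge0.
rewrite -fsbig_seq // /window_normsq -sumEFin.
by apply: eq_bigr => s _; rewrite Re_inner.
Qed.

Lemma l2normsq_le xi M : (forall W, uniq W -> window_normsq xi W <= M) ->
  (l2normsq xi <= M%:E)%E.
Proof.
move=> HM; apply: ge_ereal_sup => _ [X [/finite_seqP[W XW] _] <-].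
have -> : X = [set` undup W].
  by rewrite XW; apply/seteqP; split=> t /=; rewrite mem_undup.
rewrite -fsbig_seq ?undup_uniq // sumEFin lee_fin.
rewrite (le_trans _ (HM _ (undup_uniq W))) //.
by apply: ler_sum => s _; rewrite Re_inner.
Qed.

(** Cutting a vector down to the finitely many coordinates that enter in a given
    window of its image shows that the reduced norm is already determined by
    finitely supported vectors and finite windows. *)
Lemma reduced_normsq_le f M : 0 <= M -> finsupp_fun f ->
  (forall W F xi, uniq W -> uniq F -> (forall s, s \notin W -> xi s = 0) ->
     window_normsq (regular_rep alpha rho f xi) F <= M * window_normsq xi W) ->
  (reduced_normsq alpha rho f <= M%:E)%E.
Proof.
move=> M0 /finsuppP[T uT fT] HM; apply: ge_ereal_sup => _ [xi /= xi1 <-].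
apply: l2normsq_le => F uF.
pose W := undup [seq (t^-1 * s)%g | t <- T, s <- F].
pose xi' s := if s \in W then xi s else 0.
have uW : uniq W by exact: undup_uniq.
have -> : window_normsq (regular_rep alpha rho f xi) F =
          window_normsq (regular_rep alpha rho f xi') F.
  apply: eq_big_seq => s sF; congr (hnorm _ ^+ 2).
  rewrite !(regular_repE _ _ uT fT); apply: eq_big_seq => t tT.
  by rewrite /xi' ifT // mem_undup; apply/allpairsP; exists (t, s).
apply: le_trans (HM W F xi' uW uF _) _ => [s /negbTE sW|]; first by rewrite /xi' sW.
have -> : window_normsq xi' W = window_normsq xi W.
  by apply: eq_big_seq => s sW; rewrite /xi' sW.
have := le_trans (window_le_l2normsq xi uW) xi1; rewrite lee_fin => h.
by rewrite -[leRHS]mulr1 ler_wpM2l.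
Qed.

Lemma window_normsq_le f N W F xi : finsupp_fun f -> 0 <= N ->
  (reduced_normsq alpha rho f <= N%:E)%E ->
  uniq W -> uniq F -> (forall s, s \notin W -> xi s = 0) ->
  window_normsq (regular_rep alpha rho f xi) F <= N * window_normsq xi W.
Proof.
move=> ff N0 fN uW uF xiW.
have [w0|w0] := eqVneq (window_normsq xi W) 0.
  have xi0 s : xi s = 0.
    have [sW|/xiW//] := boolP (s \in W).
    move/eqP: w0; rewrite psumr_eq0 => [/allP/(_ s sW)/=|t _]; last exact: sqr_ge0.
    by rewrite sqrf_eq0 => /eqP/hnorm_eq0.
  rewrite w0 mulr0 /window_normsq big1 // => s _.
  rewrite /regular_rep fsbig1 ?hnorm0 ?expr0n // => t _.
  by rewrite xi0 linear0.
have w_gt0 : 0 < window_normsq xi W by rewrite lt_def w0 window_normsq_ge0.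
set k := (Num.sqrt (window_normsq xi W))^-1.
have k2 : k ^+ 2 = (window_normsq xi W)^-1.
  by rewrite exprVn sqr_sqrtr // ltW.
have scal (zeta : G -> H) c V :
    window_normsq (fun s => c%:C%C *: zeta s) V = c ^+ 2 * window_normsq zeta V.
  rewrite mulr_sumr; apply: eq_bigr => s _.
  by rewrite hnormZ exprMn real_normK ?num_real.
have : ((window_normsq (regular_rep alpha rho f (fun s => k%:C%C *: xi s)) F)%:E
    <= N%:E)%E.
  rewrite (le_trans (window_le_l2normsq _ uF)) // (le_trans _ fN) //.
  apply: ereal_sup_ubound; exists (fun s => k%:C%C *: xi s) => //=.
  rewrite (@l2normsq_window _ W) // => [|s sW]; last by rewrite xiW // scaler0.
  by rewrite scal k2 mulVf.
rewrite lee_fin.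
have -> : window_normsq (regular_rep alpha rho f (fun s => k%:C%C *: xi s)) F =
  window_normsq (fun s => k%:C%C *: regular_rep alpha rho f xi s) F.
  by apply: eq_bigr => s _; rewrite regular_repZ.
by rewrite scal k2 mulrC ler_pdivrMr.
Qed.

Lemma window_filter xi W (p : pred G) :
  window_normsq (fun s => if p s then xi s else 0) W
    + window_normsq (fun s => if ~~ p s then xi s else 0) W = window_normsq xi W.
Proof.
rewrite -big_split; apply: eq_bigr => s _ /=.
by case: (p s); rewrite /= hnorm0 expr0n ?addr0 ?add0r.
Qed.

(** If [U] is a subgroup then [restrict U f] preserves each subspace of vectors
    supported in a coset [U s], on which it is the compression of [f]. As these
    subspaces are orthogonal, the norm does not increase. *)
Lemma window_restrict_le (U : set G) f N : subgroup U -> finsupp_fun f -> 0 <= N ->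
  (reduced_normsq alpha rho f <= N%:E)%E -> forall n W F xi, (size F <= n)%N ->
  uniq W -> uniq F -> (forall s, s \notin W -> xi s = 0) ->
  window_normsq (regular_rep alpha rho (restrict U f) xi) F
    <= N * window_normsq xi W.
Proof.
move=> [U1 UB] ff N0 fN; elim=> [|n IH] W F xi.
  rewrite leqn0 => /nilP -> _ _ _; rewrite /window_normsq big_nil.
  by rewrite mulr_ge0 // window_normsq_ge0.
case: F => [|s0 F] sF uW uF xiW.
  rewrite /window_normsq big_nil.
  by rewrite mulr_ge0 // window_normsq_ge0.
pose C : pred G := fun s => (s * s0^-1)%g \in U.
have UV := group_closedV (conj U1 UB).
have UM := group_closedM (conj U1 UB).
have CE t s : C s -> C (t^-1 * s)%g = (t \in U).
  rewrite /C -mulgA => Cs; apply/idP/idP => [h|tU]; last by apply: UM; [apply: UV|].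
  have := UM _ _ Cs (UV _ h); by rewrite invgM invgK mulVKg.
have CN t s : t \in U -> ~~ C s -> ~~ C (t^-1 * s)%g.
  move=> tU; apply: contra; rewrite /C -mulgA => h.
  by have := UM _ _ tU h; rewrite mulVKg.
pose xi1 s := if C s then xi s else 0.
pose xi2 s := if ~~ C s then xi s else 0.
rewrite -(window_filter xi W C) mulrDr.
rewrite /window_normsq (bigID C) /=; apply: lerD.
  rewrite -big_filter.
  apply: le_trans (window_normsq_le ff N0 fN uW (filter_uniq C uF) _); last first.
    by move=> s /xiW ->; rewrite if_same.
  rewrite le_eqVlt; apply/orP; left; apply/eqP; apply: eq_big_seq => s.
  rewrite mem_filter => /andP[Cs _]; congr (hnorm _ ^+ 2).
  apply: eq_fsbigr => t _; rewrite /restrict CE //.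
  by case: ifP => // _; rewrite raddf0 rho_0 linear0.
rewrite -big_filter.
have szF : (size [seq i <- s0 :: F | ~~ C i] <= n)%N.
  have C0 : C s0 by rewrite /C mulgV.
  by rewrite /= C0 /= size_filter (leq_trans (count_size _ _)).
apply: le_trans (IH W _ xi2 szF uW (filter_uniq _ uF) _); last first.
  by move=> s /xiW; rewrite /xi2 => ->; rewrite if_same.
rewrite le_eqVlt; apply/orP; left; apply/eqP; apply: eq_big_seq => s.
rewrite mem_filter => /andP[Cs _]; congr (hnorm _ ^+ 2).
apply: eq_fsbigr => t _; rewrite /restrict /xi2; case: ifP => [tU|_].
  by rewrite CN.
by rewrite raddf0 !rho_0.
Qed.

End RegularRepresentation.

(** * The conditional expectation *)

Section CrossedProduct.
Variables (R : realType) (G : groupType) (A : cstarAlgType R).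
Variables (alpha : star_action G A) (H : hilbertType R) (rho : faithful_rep A H).
Variables (B : cstarAlgType R) (P : reduced_crossed_product alpha rho B).
Implicit Types (f g : G -> A) (T : seq G) (a b : A) (x y z : B) (U : set G).

Local Notation iota := (rcp_iota P).
Local Notation u := (rcp_u P).

Definition cp_sum f : B := \sum_(t \in [set: G]) iota (f t) * u t.

Lemma cp_sumE f T : uniq T -> (forall t, t \notin T -> f t = 0) ->
  cp_sum f = \sum_(t <- T) iota (f t) * u t.
Proof. by move=> uT fT; apply: fsum_seq => // t /fT ->; rewrite rmorph0 mul0r. Qed.

Lemma cp_sum_single s a : cp_sum (single s a) = iota a * u s.
Proof.
rewrite (@cp_sumE _ [:: s]) // => [|t]; first by rewrite big_seq1 /single eqxx.
by rewrite inE /single => /negbTE ->.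
Qed.

Lemma cp_sumD f g : finsupp_fun f -> finsupp_fun g ->
  cp_sum (fun t => f t + g t) = cp_sum f + cp_sum g.
Proof.
move=> /finsuppP[T _ fT] /finsuppP[F _ gF].
have uTF : uniq (undup (T ++ F)) by exact: undup_uniq.
have fTF t : t \notin undup (T ++ F) -> f t = 0.
  by rewrite mem_undup mem_cat negb_or => /andP[/fT].
have gTF t : t \notin undup (T ++ F) -> g t = 0.
  by rewrite mem_undup mem_cat negb_or => /andP[_ /gF].
rewrite (cp_sumE uTF fTF) (cp_sumE uTF gTF) (cp_sumE uTF) => [|t tn]; last first.
  by rewrite fTF // gTF // addr0.
by rewrite -big_split; apply: eq_bigr => t _; rewrite rmorphD mulrDl.
Qed.

Lemma cp_sumB f g : finsupp_fun f -> finsupp_fun g ->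
  cp_sum (fun t => f t - g t) = cp_sum f - cp_sum g.
Proof.
move=> ff fg; apply/eqP; rewrite eq_sym subr_eq -cp_sumD //; last exact: finsupp_sub.
by apply/eqP; congr cp_sum; apply/funext => t; rewrite subrK.
Qed.

Lemma rcp_u1 : u 1%g = 1.
Proof.
have [h _] := rcp_unitary P 1%g.
by have := rcp_uM P 1%g 1%g; rewrite mulg1 => /(congr1 ( *%R (star (u 1%g)))); rewrite mulrA h mul1r.
Qed.

Lemma star_rcp_u t : star (u t) = u t^-1%g.
Proof.
have [h _] := rcp_unitary P t.
by rewrite -[LHS]mulr1 -rcp_u1 -(mulgV t) rcp_uM mulrA h mul1r.
Qed.

Lemma rcp_uKV t x : x * u t^-1%g * u t = x.
Proof. by rewrite -mulrA -rcp_uM mulVg rcp_u1 mulr1. Qed.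

Lemma rcp_comm t a : u t * iota a = iota (alpha t a) * u t.
Proof. by rewrite -rcp_covariant star_rcp_u rcp_uKV. Qed.

Lemma cnorm_rcp_u t : cnorm (u t) = 1.
Proof. exact/cnorm_unitary/rcp_unitary. Qed.

Lemma cp_sum_dense y e : 0 < e -> exists2 f, finsupp_fun f & cnorm (y - cp_sum f) < e.
Proof.
move=> e0; have : [set: B] y by [].
by rewrite -(rcp_dense P) => /(_ e e0)[_ [f ff <-]] h; exists f.
Qed.

Lemma reduced_normsq_cp_sum f : finsupp_fun f ->
  reduced_normsq alpha rho f = (cnorm (cp_sum f) ^+ 2)%:E.
Proof. by move=> ff; rewrite -(rcp_norm P ff). Qed.

Lemma cnorm_restrict U f : subgroup U -> finsupp_fun f ->
  cnorm (cp_sum (restrict U f)) <= cnorm (cp_sum f).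
Proof.
move=> sU ff; rewrite -(@ler_pXn2r _ 2) ?nnegrE ?cnorm_ge0 // -lee_fin.
rewrite -reduced_normsq_cp_sum; last exact: finsupp_restrict.
apply: reduced_normsq_le => [||W F xi uW uF xiW]; first exact: sqr_ge0.
  exact: finsupp_restrict.
apply: (window_restrict_le sU ff (sqr_ge0 _) _ (leqnn (size F))) => //.
by rewrite reduced_normsq_cp_sum.
Qed.

Lemma hnorm_rho_iota a h : hnorm (rho a h) <= cnorm (iota a) * hnorm h.
Proof.
have fa := finsupp_single (1%g : G) a.
pose xi t := if t == 1%g :> G then h else 0.
have := @window_normsq_le _ _ _ alpha _ rho _ (cnorm (iota a) ^+ 2) [:: 1%g] [:: 1%g] xi fa.
rewrite reduced_normsq_cp_sum // cp_sum_single rcp_u1 mulr1 sqr_ge0.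
move=> /(_ isT (lexx _) isT isT).
rewrite /window_normsq !big_seq1 (@regular_repE _ _ _ _ _ _ _ _ _ [:: 1%g]) //; last first.
  by move=> t; rewrite inE /single => /negbTE ->.
rewrite big_seq1 /single /xi !mulg1 eqxx -exprMn invg1 act1 eqxx.
rewrite ler_pXn2r ?nnegrE ?mulr_ge0 ?cnorm_ge0 ?hnorm_ge0 //; apply.
by move=> t; rewrite inE => /negbTE ->.
Qed.

Lemma rcp_iota_inj a : iota a = 0 -> a = 0.
Proof.
move=> a0; apply: (rep_faithful (f := rho)) => h; apply: hnorm_eq0; apply/eqP.
by rewrite eq_le hnorm_ge0 andbT (le_trans (hnorm_rho_iota _ _)) // a0 cnorm0 mul0r.
Qed.

Lemma cnorm_iota a : cnorm (iota a) = cnorm a.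
Proof. exact: (cnorm_smorph_inj (rcp_iota_star P) rcp_iota_inj). Qed.

Lemma hnorm_rho a h : hnorm (rho a h) <= cnorm a * hnorm h.
Proof. by rewrite -cnorm_iota hnorm_rho_iota. Qed.

Lemma subgroup1 : subgroup [set 1%g : G].
Proof. by split; rewrite ?inE // => s t; rewrite !inE => -> ->; rewrite divg1. Qed.

(** Up to the isometry [iota], this is the contractivity of the restriction to
    the trivial subgroup. *)
Lemma cnorm_coef1 f : finsupp_fun f -> cnorm (f 1%g) <= cnorm (cp_sum f).
Proof.
move=> ff; rewrite -cnorm_iota (le_trans _ (cnorm_restrict subgroup1 ff)) //.
suff -> : restrict [set 1%g] f = single 1%g (f 1%g).
  by rewrite cp_sum_single rcp_u1 mulr1.
apply/funext => t; rewrite /restrict /single.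
by have [->|/eqP t1] := eqVneq t 1%g; [rewrite ifT ?inE|rewrite ifF //; apply/negP; rewrite inE].
Qed.

(** Only the distances to finite sums are recorded for the extended value [l]:
    they determine it, by density, and all its properties follow from them. *)
Lemma cp_extension (C : cstarAlgType R) (h : (G -> A) -> C) :
  (forall f g, finsupp_fun f -> finsupp_fun g ->
     cnorm (h f - h g) <= cnorm (cp_sum f - cp_sum g)) ->
  forall y, exists l, forall f, finsupp_fun f ->
    cnorm (l - h f) <= cnorm (y - cp_sum f).
Proof.
move=> hle y.
have /choice[F HF] (n : nat) : exists f, finsupp_fun f /\
    cnorm (y - cp_sum f) < n.+1%:R^-1.
  have [|f ff yf] := @cp_sum_dense y (n.+1%:R^-1); first by rewrite invr_gt0.
  by exists f.
have small e : 0 < e -> exists N, forall n, (N <= n)%N -> cnorm (y - cp_sum (F n)) < e.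
  move=> e0; exists (Num.truncn e^-1) => n Nn.
  apply: lt_trans (proj2 (HF n)) _.
  rewrite -[ltRHS]invrK ltf_pV2 ?posrE ?invr_gt0 //.
  apply: lt_le_trans (truncnS_gt _) _.
  by rewrite ler_nat ltnS.
have hF n f : finsupp_fun f -> cnorm (h (F n) - h f)
    <= cnorm (y - cp_sum (F n)) + cnorm (y - cp_sum f).
  move=> ff; apply: le_trans (hle _ _ (proj1 (HF n)) ff) _.
  by rewrite (le_trans (cnormB_trans y _ _)) // cnorm_distC.
have [|l Hl] := @cnorm_cauchy_cvg _ _ (h \o F).
  move=> e e0; have [N HN] := small _ (divr_gt0 e0 (ltr0n R 2)).
  exists N => m n /HN hm /HN hn.
  by apply: le_lt_trans (hF _ _ (proj1 (HF n))) _; lra.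
exists l => f ff; apply/ler_addgt0Pr => e e0.
have e2 := divr_gt0 e0 (ltr0n R 2).
have [N HN] := small _ e2; have [M HM] := Hl _ e2.
have := HN _ (leq_maxl N M); have := HM _ (leq_maxr N M); rewrite /= cnorm_distC.
have := cnormB_trans (h (F (maxn N M))) l (h f); have := hF (maxn N M) _ ff; lra.
Qed.

(** The bimodule and covariance identities for the expectation are equalities of
    such maps, so that it is enough to check them on monomials. *)
Definition bounded_additive (C : cstarAlgType R) (h : B -> C) :=
  (forall x y, h (x - y) = h x - h y) /\
  exists2 K : R, 0 <= K & forall x, cnorm (h x) <= K * cnorm x.

Lemma bounded_additive_eq0 (C : cstarAlgType R) (h : B -> C) :
  bounded_additive h -> (forall a t, h (iota a * u t) = 0) -> forall x, h x = 0.
Proof.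
move=> [hB [K K0 hK]] h0 x; apply: cnorm_small => e e0.
have K1 : 0 < K + 1 by lra.
have [f ff xf] := cp_sum_dense x (divr_gt0 e0 K1).
have h00 : h 0 = 0 by rewrite -(subrr 0) hB subrr.
have hD y z : h (y + z) = h y + h z by rewrite -{1}[z]opprK -[- z]sub0r !hB h00 sub0r opprK.
have hf : h (cp_sum f) = 0.
  have /finsuppP[T uT fT] := ff; rewrite (cp_sumE uT fT).
  by rewrite (big_morph h hD h00) big1.
rewrite -[h x]subr0 -hf -hB (le_trans (hK _)) //.
have : (K + 1) * cnorm (x - cp_sum f) < e by rewrite mulrC -ltr_pdivlMr.
have := cnorm_ge0 (x - cp_sum f); nra.
Qed.

Lemma cond_exp_exists y : exists a, forall f, finsupp_fun f ->
  cnorm (a - f 1%g) <= cnorm (y - cp_sum f).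
Proof.
apply: (cp_extension (h := fun f => f 1%g)) => f g ff fg.
rewrite -cp_sumB //; exact: (cnorm_coef1 (finsupp_sub ff fg)).
Qed.

Definition cond_exp y : A := projT1 (cid (cond_exp_exists y)).

Lemma cond_expP y f : finsupp_fun f ->
  cnorm (cond_exp y - f 1%g) <= cnorm (y - cp_sum f).
Proof. exact: (projT2 (cid (cond_exp_exists y))). Qed.

Lemma cond_exp_cp_sum f : finsupp_fun f -> cond_exp (cp_sum f) = f 1%g.
Proof.
move=> /(cond_expP (cp_sum f)); rewrite subrr cnorm0 => h.
apply/eqP; rewrite -subr_eq0; apply/eqP/cnorm_eq0/eqP.
by rewrite eq_le h cnorm_ge0.
Qed.

Lemma cond_expB x y : cond_exp (x - y) = cond_exp x - cond_exp y.
Proof.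
apply/eqP; rewrite -subr_eq0; apply/eqP/cnorm_small => e e0.
have e4 := divr_gt0 e0 (ltr0n R 4).
have [f ff xf] := cp_sum_dense x e4; have [g fg yg] := cp_sum_dense y e4.
have h1 := cond_expP (x - y) (finsupp_sub ff fg).
have h2 := cond_expP x ff; have h3 := cond_expP y fg.
have h4 : cnorm (x - y - cp_sum (fun t => f t - g t)) <=
    cnorm (x - cp_sum f) + cnorm (y - cp_sum g).
  by rewrite cp_sumB // subrACA (le_trans (ler_cnormD _ _)) // cnormN.
have := cnormB_trans (f 1%g - g 1%g) (cond_exp (x - y)) (cond_exp x - cond_exp y).
have : cnorm (f 1%g - g 1%g - (cond_exp x - cond_exp y)) <=
    cnorm (cond_exp x - f 1%g) + cnorm (cond_exp y - g 1%g).
  rewrite subrACA (le_trans (ler_cnormD _ _)) // cnormN.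
  by rewrite [cnorm (f _ - _)]cnorm_distC [cnorm (g _ - _)]cnorm_distC.
lra.
Qed.

Lemma cnorm_cond_exp y : cnorm (cond_exp y) <= cnorm y.
Proof.
have := cond_expP y (finsupp0 G A); rewrite subr0.
by rewrite (@cp_sumE _ [::]) // big_nil subr0.
Qed.

Lemma cond_exp_iota a : cond_exp (iota a) = a.
Proof.
have := cond_exp_cp_sum (finsupp_single 1%g a).
by rewrite cp_sum_single rcp_u1 mulr1 /single eqxx.
Qed.

Lemma cond_exp_monomial a t : cond_exp (iota a * u t) = if t == 1%g then a else 0.
Proof.
have := cond_exp_cp_sum (finsupp_single t a).
by rewrite cp_sum_single /single eq_sym.
Qed.

Lemma cond_exp0 : cond_exp 0 = 0.
Proof. by rewrite -(subrr 0) cond_expB subrr. Qed.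

Lemma cond_expD x y : cond_exp (x + y) = cond_exp x + cond_exp y.
Proof.
by rewrite -{1}[y]opprK -[- y]sub0r !cond_expB cond_exp0 sub0r opprK.
Qed.

Lemma cond_exp_sum (I : Type) (s : seq I) (F : I -> B) :
  cond_exp (\sum_(i <- s) F i) = \sum_(i <- s) cond_exp (F i).
Proof. exact: (big_morph _ cond_expD cond_exp0). Qed.

Lemma cond_exp_mull a y : cond_exp (iota a * y) = a * cond_exp y.
Proof.
apply/eqP; rewrite -subr_eq0; apply/eqP; move: y.
apply: bounded_additive_eq0 => [|b t].
  split=> [x y|]; first by rewrite mulrBr !cond_expB mulrBr subrACA.
  exists (cnorm a + cnorm a) => [|x]; first by rewrite addr_ge0 ?cnorm_ge0.
  rewrite (le_trans (ler_cnormD _ _)) // cnormN mulrDl lerD //.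
    by rewrite (le_trans (cnorm_cond_exp _)) // -(cnorm_iota a) ler_cnormM.
  rewrite (le_trans (ler_cnormM _ _)) // ler_wpM2l ?cnorm_ge0 //.
  exact: cnorm_cond_exp.
rewrite mulrA -rmorphM !cond_exp_monomial.
by case: ifP; rewrite ?mulr0 subrr.
Qed.

Lemma cond_exp_mulr a y : cond_exp (y * iota a) = cond_exp y * a.
Proof.
apply/eqP; rewrite -subr_eq0; apply/eqP; move: y.
apply: bounded_additive_eq0 => [|b t].
  split=> [x y|]; first by rewrite mulrBl !cond_expB mulrBl subrACA.
  exists (cnorm a + cnorm a) => [|x]; first by rewrite addr_ge0 ?cnorm_ge0.
  rewrite (le_trans (ler_cnormD _ _)) // cnormN mulrDl lerD //.
    rewrite (le_trans (cnorm_cond_exp _)) // -(cnorm_iota a) mulrC ler_cnormM //.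
  rewrite (le_trans (ler_cnormM _ _)) // mulrC ler_wpM2l ?cnorm_ge0 //.
  exact: cnorm_cond_exp.
rewrite -mulrA rcp_comm mulrA -rmorphM !cond_exp_monomial.
by case: eqP => [->|_]; rewrite ?act1 ?mul0r subrr.
Qed.

Lemma cond_exp_conj s y :
  cond_exp (u s * y * u s^-1%g) = alpha s (cond_exp y).
Proof.
apply/eqP; rewrite -subr_eq0; apply/eqP; move: y.
apply: bounded_additive_eq0 => [|b t].
  split=> [x y|].
    by rewrite mulrBr mulrBl !cond_expB raddfB subrACA.
  exists 2 => // x.
  rewrite (le_trans (ler_cnormD _ _)) // cnormN cnorm_act.
  have h1 := cnorm_cond_exp (u s * x * u s^-1%g); have h2 := cnorm_cond_exp x.
  have := ler_cnormM (u s * x) (u s^-1%g); have := ler_cnormM (u s) x.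
  by rewrite !cnorm_rcp_u mulr1 mul1r; lra.
rewrite mulrA rcp_comm -!mulrA -!rcp_uM !cond_exp_monomial mulgA.
rewrite divg_eq1.
have -> : ((s * t)%g == s) = (t == 1%g).
  by apply/eqP/eqP => [|->]; rewrite ?mulg1 // -[in RHS](mulg1 s) => /mulgI.
by case: (t == 1%g); rewrite /= ?raddf0 ?subrr ?addr0.
Qed.

(** The value [z] is the conditional expectation of [y] onto the crossed product
    by [U]. *)
Lemma cond_exp_subgroup_exists U : subgroup U -> forall y, exists z,
  forall f, finsupp_fun f ->
    cnorm (z - cp_sum (restrict U f)) <= cnorm (y - cp_sum f).
Proof.
move=> sU; apply: cp_extension => f g ff fg.
rewrite -!cp_sumB //; try exact: finsupp_restrict.
rewrite (le_trans _ (cnorm_restrict sU (finsupp_sub ff fg))) //.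
suff -> : (fun t => restrict U f t - restrict U g t) =
          restrict U (fun t => f t - g t) by [].
by apply/funext => t; rewrite /restrict; case: ifP; rewrite ?subr0.
Qed.

End CrossedProduct.

(** * Faithfulness of the conditional expectation *)

Lemma big_pred1_uniq (V : nmodType) (I : eqType) (r : seq I) i (F : I -> V) :
  uniq r -> i \in r -> \sum_(j <- r | j == i) F j = F i.
Proof.
move=> ur ir; rewrite big_mkcond (bigD1_seq i) //= eqxx big1 ?addr0 // => j.
by move=> /negbTE ->.
Qed.

Section Faithfulness.
Variables (R : realType) (G : groupType) (A : cstarAlgType R).
Variables (alpha : star_action G A) (H : hilbertType R) (rho : faithful_rep A H).
Variables (B : cstarAlgType R) (P : reduced_crossed_product alpha rho B).
Implicit Types (f g : G -> A) (T : seq G) (a b : A) (x y z : B) (U : set G).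

Local Notation iota := (rcp_iota P).
Local Notation u := (rcp_u P).
Local Notation E := (cond_exp P).

Lemma coef_cp_sum f t : finsupp_fun f -> E (cp_sum P f * u t^-1%g) = f t.
Proof.
move=> /finsuppP[T uT fT]; rewrite (cp_sumE P uT fT) mulr_suml cond_exp_sum.
under eq_bigr do rewrite -mulrA -rcp_uM cond_exp_monomial divg_eq1.
rewrite -big_mkcond /=; have [tT|tT] := boolP (t \in T).
  by rewrite big_pred1_uniq.
by rewrite fT // big1_seq // => s /andP[/eqP -> sT]; rewrite sT in tT.
Qed.

Lemma coef_dist y f t : finsupp_fun f ->
  cnorm (E (y * u t^-1%g) - f t) <= cnorm (y - cp_sum P f).
Proof.
move=> ff; rewrite -(coef_cp_sum t ff) -cond_expB -mulrBl.
apply: le_trans (cnorm_cond_exp _ _) _.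
by have := ler_cnormM (y - cp_sum P f) (u t^-1%g); rewrite cnorm_rcp_u mulr1.
Qed.

Lemma hnorm_regular_rep_le f (xi : G -> H) (W : seq G) s eta :
  (forall t, cnorm (f t) <= eta) -> uniq W -> (forall r, r \notin W -> xi r = 0) ->
  hnorm (regular_rep alpha rho f xi s) <= eta * \sum_(r <- W) hnorm (xi r).
Proof.
move=> feta uW xiW.
have inj : injective (fun r : G => (s * r^-1)%g) by move=> r r' /divgI.
rewrite /regular_rep (@fsum_seq _ _ [seq (s * r^-1)%g | r <- W]) ?map_inj_uniq //.
  rewrite big_map (le_trans (hnorm_sum _ _)) // mulr_sumr; apply: ler_sum => r _.
  rewrite invgF mulgVK (le_trans (hnorm_rho P _ _)) // cnorm_act //.
  by rewrite ler_wpM2r ?hnorm_ge0.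
move=> t tW; rewrite xiW ?linear0 //; apply: contra tW => tW.
by apply/mapP; exists (t^-1 * s)%g => //; rewrite invgM invgK mulVKg.
Qed.

(** Finite sums close to [y] have small coefficients, hence act by nearly zero on
    finitely supported vectors when tested on a fixed finite window; the
    difference of two such sums is small in norm. *)
Lemma coef_eq0 y : (forall t, E (y * u t^-1%g) = 0) -> y = 0.
Proof.
move=> y0; apply: cnorm_small => e0 e0_gt0.
set e := e0 / 4; have e_gt0 : 0 < e by rewrite divr_gt0.
have [f ff yf] := cp_sum_dense P y e_gt0.
suff : cnorm (cp_sum P f) ^+ 2 <= 8 * e ^+ 2.
  have -> : 8 * e ^+ 2 = (2 * e) ^+ 2 + (2 * e) ^+ 2 by ring.
  move=> h; have h' : cnorm (cp_sum P f) ^+ 2 <= (3 * e) ^+ 2.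
    by rewrite (le_trans h) // !expr2; nra.
  rewrite ler_pXn2r ?nnegrE ?cnorm_ge0 // in h'; last by rewrite mulr_ge0 // ltW.
  have := cnormB_trans (cp_sum P f) y 0; rewrite !subr0 /e in yf h' *.
  by lra.
rewrite -lee_fin -reduced_normsq_cp_sum //.
apply: reduced_normsq_le => [||W F xi uW uF xiW] //.
  by rewrite mulr_ge0 // sqr_ge0.
set N := window_normsq xi W; set C := \sum_(r <- W) hnorm (xi r).
have N0 : 0 <= N by exact: window_normsq_ge0.
apply/ler_addgt0Pr => d d_gt0.
set K : R := 2 * (size F)%:R * C ^+ 2.
have K0 : 0 <= K by rewrite mulr_ge0 ?sqr_ge0 // mulr_ge0.
have K1 : 0 < K + 1 by lra.
pose eta := Num.min e (Num.min 1 (d / (K + 1))).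
have eta_gt0 : 0 < eta by rewrite !lt_min e_gt0 ltr01 divr_gt0.
have [eta_e eta_1 eta_d] : [/\ eta <= e, eta <= 1 & eta <= d / (K + 1)].
  have := lexx eta; rewrite {2}/eta !le_min => /and3P[]; by split.
have [g gf yg] := cp_sum_dense P y eta_gt0.
have g_small t : cnorm (g t) <= eta.
  have := coef_dist y t gf; rewrite y0 sub0r cnormN => h.
  by rewrite (le_trans h) // ltW.
have ffg := finsupp_sub ff gf.
have wfg : window_normsq (regular_rep alpha rho (fun t => f t - g t) xi) F
    <= (2 * e) ^+ 2 * N.
  apply: le_trans (window_normsq_le ffg (sqr_ge0 _) _ uW uF xiW) _.
    by rewrite (reduced_normsq_cp_sum P).
  rewrite ler_wpM2r // ler_pXn2r ?nnegrE ?cnorm_ge0 //; last lra.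
  rewrite cp_sumB // (le_trans (cnormB_trans y _ _)) // cnorm_distC; lra.
have wg s : hnorm (regular_rep alpha rho g xi s) ^+ 2 <= eta ^+ 2 * C ^+ 2.
  rewrite -exprMn ler_pXn2r ?nnegrE ?hnorm_ge0 ?mulr_ge0 ?sumr_ge0 //.
  - exact: hnorm_regular_rep_le.
  - exact: ltW.
  - by move=> r _; exact: hnorm_ge0.
have step : window_normsq (regular_rep alpha rho f xi) F <=
  2 * window_normsq (regular_rep alpha rho (fun t => f t - g t) xi) F +
  \sum_(s <- F) 2 * (eta ^+ 2 * C ^+ 2).
  rewrite mulr_sumr -big_split /=; apply: ler_sum => s _.
  have -> : regular_rep alpha rho f xi s =
    regular_rep alpha rho (fun t => f t - g t) xi s + regular_rep alpha rho g xi s.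
    by rewrite regular_repB // subrK.
  by rewrite (le_trans (hnorm_sqrD _ _)) // lerD2l ler_wpM2l.
have eF : \sum_(s <- F) 2 * (eta ^+ 2 * C ^+ 2) = eta ^+ 2 * K.
  by rewrite big_const_seq count_predT iter_addr_0 -mulr_natr /K; ring.
have hd : eta ^+ 2 * K <= d.
  have : eta * (K + 1) <= d by rewrite -ler_pdivlMr.
  have : eta ^+ 2 <= eta by rewrite expr2 -{3}[eta]mulr1 ler_wpM2l // ltW.
  by nra.
rewrite (le_trans step) // eF; apply: lerD => //.
have -> : 8 * e ^+ 2 * N = 2 * ((2 * e) ^+ 2 * N) by ring.
by rewrite ler_wpM2l.
Qed.

Lemma star_monomialM s t a b :
  star (iota a * u s) * (iota b * u t) =
  iota (alpha s^-1%g (star a * b)) * u (s^-1 * t)%g.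
Proof.
rewrite starM star_rcp_u -rcp_iota_star !mulrA -[_ * iota b]mulrA -rmorphM.
by rewrite rcp_comm -mulrA -rcp_uM.
Qed.

Lemma cond_exp_star_mul f T : uniq T -> (forall t, t \notin T -> f t = 0) ->
  E (star (cp_sum P f) * cp_sum P f) =
  \sum_(t <- T) alpha t^-1%g (star (f t) * f t).
Proof.
move=> uT fT; rewrite !(cp_sumE P uT fT) star_sum big_distrlr /= cond_exp_sum.
apply: eq_big_seq => s sT; rewrite cond_exp_sum.
under eq_bigr => t _.
  rewrite star_monomialM cond_exp_monomial mulg_eq1 eqg_inv eq_sym.
  over.
by rewrite -big_mkcond /= big_pred1_uniq.
Qed.

(** The left side is one term of the sum [inner (rho z h) h] of nonnegative
    terms, where [z = E (star x * x)] and [x] is the finite sum. *)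
Lemma hnorm_coef_sqr_le f t h : finsupp_fun f ->
  hnorm (rho (alpha t^-1%g (f t)) h) ^+ 2 <=
    cnorm (E (star (cp_sum P f) * cp_sum P f)) *
    (cnorm (E (star (cp_sum P f) * cp_sum P f)) + 1) * hnorm h ^+ 2.
Proof.
move=> /finsuppP[T uT fT]; set d := cnorm _.
have d0 : 0 <= d by exact: cnorm_ge0.
have h0 := hnorm_ge0 h.
have rhs0 : 0 <= d * (d + 1) * hnorm h ^+ 2.
  by rewrite !mulr_ge0 ?sqr_ge0 //; lra.
have [tT|/fT ->] := boolP (t \in T); last first.
  by rewrite raddf0 (rho_0 rho) hnorm0 expr0n.
set z := E (star (cp_sum P f) * cp_sum P f) in d d0 rhs0 *.
have zE : complex.Re (inner (rho z h) h) =
    \sum_(s <- T) hnorm (rho (alpha s^-1%g (f s)) h) ^+ 2.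
  rewrite /z (cond_exp_star_mul uT fT) rho_sum.
  rewrite (big_morph (fun v => inner v h) (fun v w => linearDl inner h v w)
     (linear0l inner h)).
  have ReD : {morph @complex.Re R : v w / v + w} by case=> ? ? [].
  rewrite (big_morph _ ReD (erefl : complex.Re (0 : R[i]) = 0)).
  apply: eq_bigr => s _.
  by rewrite rmorphM /= repM act_star rep_star Re_inner.
have : hnorm (rho (alpha t^-1%g (f t)) h) ^+ 2 <= complex.Re (inner (rho z h) h).
  rewrite zE (bigD1_seq t) //= lerDl sumr_ge0 // => s _; exact: sqr_ge0.
move=> /le_trans; apply; apply: le_trans (Re_inner_le _ _) _.
have hz := hnorm_rho P z h; rewrite -/d in hz; have hz0 := hnorm_ge0 (rho z h).
have -> : d * (d + 1) * hnorm h ^+ 2 = (d * hnorm h) * (d * hnorm h + hnorm h).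
  by ring.
by apply: ler_pM; rewrite ?addr_ge0 // lerD2r.
Qed.

(** Each coefficient of [y] is bounded by [E (star y * y)], because [E (star y * y)]
    is the sum of the squares of all coefficients, translated by the action. *)
Lemma cond_exp_faithful y : E (star y * y) = 0 -> y = 0.
Proof.
move=> y0; apply: coef_eq0 => t; set c := E _.
suff c0 : alpha t^-1%g c = 0.
  by rewrite -(act1 alpha c) -(mulgV t) actM c0 raddf0.
apply: (rep_faithful (f := rho)) => h; apply: hnorm_eq0; apply/eqP.
rewrite -(@sqrf_eq0 R) eq_le sqr_ge0 andbT.
apply/ler_addgt0Pr => d d_gt0; rewrite add0r.
set M := 2 * cnorm y + 1; have y_ge0 := cnorm_ge0 y.
have M0 : 0 <= M by rewrite /M; lra.
set L := 2 * hnorm h ^+ 2 + 2 * (M * (M + 1) * hnorm h ^+ 2).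
have h2 := sqr_ge0 (hnorm h).
have L1 : 0 < L + 1.
  by rewrite ltr_wpDl // addr_ge0 // mulr_ge0 // mulr_ge0 // mulr_ge0 // addr_ge0.
pose e := Num.min 1 (d / (L + 1)).
have e_gt0 : 0 < e by rewrite lt_min ltr01 divr_gt0.
have [e1 ed] : e <= 1 /\ e <= d / (L + 1).
  by have := lexx e; rewrite {2}/e le_min => /andP[].
have [f ff yf] := cp_sum_dense P y e_gt0.
set x := cp_sum P f in yf.
have xy : cnorm x <= cnorm y + 1.
  have := cnormB_trans y x 0; rewrite !subr0 cnorm_distC; lra.
have dM : cnorm (E (star x * x)) <= e * M.
  have -> : E (star x * x) = E (star (x - y) * x + star y * (x - y)).
    have -> : star (x - y) * x + star y * (x - y) = star x * x - star y * y.
      by rewrite starB mulrBl mulrBr addrA subrK.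
    by rewrite cond_expB y0 subr0.
  apply: le_trans (cnorm_cond_exp _ _) _; apply: le_trans (ler_cnormD _ _) _.
  have := ler_cnormM (star (x - y)) x; have := ler_cnormM (star y) (x - y).
  rewrite !cnorm_star cnorm_distC /M; have := cnorm_ge0 (y - x); have := cnorm_ge0 x; nra.
have dd := @hnorm_coef_sqr_le f t h ff; rewrite /= -/x in dd.
have cf : alpha t^-1%g c = alpha t^-1%g (c - f t) + alpha t^-1%g (f t).
  by rewrite -raddfD subrK.
rewrite cf (rho_add rho) (le_trans (hnorm_sqrD _ _)) //.
have h1 : hnorm (rho (alpha t^-1%g (c - f t)) h) ^+ 2 <= e * hnorm h ^+ 2.
  apply: (@le_trans _ _ (e ^+ 2 * hnorm h ^+ 2)).
    rewrite -exprMn ler_pXn2r ?nnegrE ?hnorm_ge0 ?mulr_ge0 ?hnorm_ge0 //; last exact: ltW.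
    rewrite (le_trans (hnorm_rho P _ _)) // cnorm_act // ler_wpM2r ?hnorm_ge0 //.
    by rewrite (le_trans (coef_dist y t ff)) // ltW.
  by rewrite ler_wpM2r // expr2 -{3}[e]mulr1 ler_wpM2l // ltW.
have h3 : hnorm (rho (alpha t^-1%g (f t)) h) ^+ 2 <= e * (M * (M + 1) * hnorm h ^+ 2).
  apply: le_trans dd _; rewrite [leRHS]mulrA ler_wpM2r // [leRHS]mulrA.
  have := cnorm_ge0 (E (star x * x)); set q := cnorm _ in dM *; move=> q0.
  by apply: ler_pM; rewrite ?addr_ge0 // lerD2r (le_trans dM) // ler_piMl.
have : e * (L + 1) <= d by rewrite -ler_pdivlMr.
rewrite /L; lra.
Qed.

End Faithfulness.

(** * Averaging by unitaries of the coefficient algebra *)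

Section Averaging.
Variables (R : realType) (G : groupType) (A : cstarAlgType R).
Variables (alpha : star_action G A) (H : hilbertType R) (rho : faithful_rep A H).
Variables (B : cstarAlgType R) (P : reduced_crossed_product alpha rho B).
Implicit Types (f g : G -> A) (T : seq G) (a b v : A) (x y z : B) (U : set G).

Local Notation iota := (rcp_iota P).
Local Notation u := (rcp_u P).
Local Notation E := (cond_exp P).

(** The averaging property concerns the orbit of a single element. Keeping the maps
    themselves lets one average act on several elements at once, and lets averages
    chosen for the successive terms of a finite sum be composed. *)
Inductive averaging : (B -> B) -> Prop :=
| averaging_conj v of unitary v :
    averaging (fun x => iota v * x * iota (star v))
| averaging_mix (c : R[i]) phi psi of 0 <= c & c <= 1 &
    averaging phi & averaging psi :
    averaging (fun x => c *: phi x + (1 - c) *: psi x)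
| averaging_comp phi psi of averaging phi & averaging psi :
    averaging (phi \o psi).

Lemma averaging_id : averaging (fun x => iota 1 * x * iota (star 1)).
Proof. exact/averaging_conj/unitary1. Qed.

Lemma averagingD phi : averaging phi -> {morph phi : x y / x + y}.
Proof.
elim=> [v _|c {}phi psi _ _ _ h1 _ h2|{}phi psi _ h1 _ h2] x y /=.
- by rewrite mulrDr mulrDl.
- by rewrite h1 h2 !scalerDr addrACA.
- by rewrite h2 h1.
Qed.

Lemma averagingB phi x y : averaging phi -> phi (x - y) = phi x - phi y.
Proof.
by move=> hphi; apply/eqP; rewrite eq_sym subr_eq -averagingD // subrK.
Qed.

Lemma averaging1 phi : averaging phi -> phi 1 = 1.
Proof.
elim=> [v [_ vv]|c {}phi psi _ _ _ h1 _ h2|{}phi psi _ h1 _ h2] /=.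
- by rewrite mulr1 -rmorphM vv rmorph1.
- by rewrite h1 h2 -scalerDl addrC subrK scale1r.
- by rewrite h2 h1.
Qed.

Lemma cnorm_averaging phi : averaging phi -> forall x, cnorm (phi x) <= cnorm x.
Proof.
elim=> [v uv|c {}phi psi c0 c1 _ h1 _ h2|{}phi psi _ h1 _ h2] x /=.
- have := ler_cnormM (iota v * x) (iota (star v)).
  have := ler_cnormM (iota v) x.
  rewrite !cnorm_iota cnorm_star (cnorm_unitary uv) mul1r mulr1; lra.
- apply: le_trans (ler_cnormD _ _) _; rewrite !cnormZ.
  rewrite ger0_norm // ger0_norm ?subr_ge0 //.
  move: c0 c1; case: c => p q; rewrite !lecE /= => /andP[_ p0] /andP[_ p1].
  by have := h1 x; have := h2 x; nra.
- exact: le_trans (h1 _) (h2 _).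
Qed.

Lemma averaging_monomial phi t b : averaging phi ->
  exists b', phi (iota b * u t) = iota b' * u t.
Proof.
move=> hphi; elim: hphi b => [v _|c {}phi psi _ _ _ h1 _ h2|{}phi psi _ h1 _ h2] b /=.
- exists (v * b * alpha t (star v)).
  by rewrite !rmorphM -!mulrA rcp_comm.
- have [b1 ->] := h1 b; have [b2 ->] := h2 b.
  exists (c *: b1 + (1 - c) *: b2).
  by rewrite !scalerAl -mulrDl linearD !linearZ.
- by have [b2 ->] := h2 b; have [b1 ->] := h1 b2; exists b1.
Qed.

(** Stability under scalars follows from that under multiplication by [A]. *)
Definition bimodule (M : set B) :=
  [/\ M 0, forall x y, M x -> M y -> M (x + y),
      forall a x, M x -> M (iota a * x) & forall a x, M x -> M (x * iota a)].

Lemma averaging_bimodule M phi : bimodule M -> averaging phi ->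
  forall x, M x -> M (phi x).
Proof.
move=> [_ MD Ml Mr]; elim=> [v _|c {}phi psi _ _ _ h1 _ h2|{}phi psi _ h1 _ h2] x Mx /=.
- exact/Mr/Ml.
- have MZ (k : R[i]) y : M y -> M (k *: y).
    by move=> My; rewrite -[y]mul1r scalerAl -(rmorph1 iota) -linearZ; exact: Ml.
  by apply: MD; apply: MZ; [exact: h1|exact: h2].
- exact/h1/h2.
Qed.

Hypothesis save : SAveP_action alpha.

(** The elements [b'] for which [b' u_t] is an average of [b u_t] form a convex set
    containing all [v b (alpha_t v)^*]. *)
Lemma averaging_kills_monomial t b e : t <> 1%g -> 0 < e ->
  exists2 phi, averaging phi & cnorm (phi (iota b * u t)) < e.
Proof.
move=> /save/(_ b) hull /hull[b' hb'].
pose K := [set b' : A | exists2 phi, averaging phi & phi (iota b * u t) = iota b' * u t].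
suff : K b'.
  move=> [phi hphi Ephi]; rewrite sub0r cnormN => b'e; exists phi => //.
  rewrite Ephi; apply: le_lt_trans (ler_cnormM _ _) _.
  by rewrite cnorm_iota cnorm_rcp_u mulr1.
apply: smallest_sub hb'.
- move=> x y k /set_mem[phi hphi Ephi] /set_mem[psi hpsi Epsi]; apply/mem_set.
  exists (fun z => k%:num *: phi z + (1 - k%:num) *: psi z).
    exact: averaging_mix.
  rewrite Ephi Epsi !scalerAl -mulrDl; congr (_ * _).
  by rewrite [RHS]linearD !linearZ.
- move=> _ [v uv <-]; exists (fun x => iota v * x * iota (star v)).
    exact: averaging_conj.
  by rewrite -act_star !rmorphM -!mulrA rcp_comm.
Qed.

(** An average sends a monomial to a monomial with the same group element, so the
    terms can be treated one after the other; contractivity keeps the earlier ones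
    small. *)
Lemma averaging_kills_sum T f e : (forall t, t \in T -> t <> 1%g) -> 0 < e ->
  exists2 phi, averaging phi & cnorm (phi (\sum_(t <- T) iota (f t) * u t)) < e.
Proof.
elim: T e => [|t T IH] e hT e0.
  by eexists; first exact: averaging_id; rewrite big_nil mulr0 mul0r cnorm0.
have e2 := divr_gt0 e0 (ltr0n R 2).
have [|phi hphi phie] := IH _ _ e2.
  by move=> s sT; apply: hT; rewrite inE sT orbT.
have [b' hb'] := averaging_monomial t (f t) hphi.
have [|psi hpsi psie] := averaging_kills_monomial b' _ e2 (t := t).
  by apply: hT; rewrite mem_head.
exists (psi \o phi); first exact: averaging_comp.
rewrite big_cons /= (averagingD hphi) hb' (averagingD hpsi).
apply: le_lt_trans (ler_cnormD _ _) _.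
have := cnorm_averaging hpsi (phi (\sum_(t0 <- T) iota (f t0) * u t0)); lra.
Qed.

Lemma averaging_to_cond_exp y e : 0 < e ->
  exists2 phi, averaging phi & cnorm (phi (y - iota (E y))) < e.
Proof.
move=> e0; have e3 := divr_gt0 e0 (ltr0n R 3).
have [f ff yf] := cp_sum_dense P y e3.
have /finsuppP[T uT fT] := ff.
have [t|phi hphi phie] := @averaging_kills_sum [seq t <- T | t != 1%g] f _ _ e3.
  by rewrite mem_filter => /andP[/eqP].
exists phi => //.
have xf : cp_sum P f = iota (f 1%g) + \sum_(t <- [seq t <- T | t != 1%g]) iota (f t) * u t.
  rewrite (cp_sumE P uT fT) big_filter (bigID (pred1 1%g)) /=; congr (_ + _).
  have [T1|T1] := boolP (1%g \in T).
    by rewrite big_pred1_uniq // rcp_u1 mulr1.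
  by rewrite fT // rmorph0 big1_seq // => s /andP[/eqP -> sT]; rewrite sT in T1.
set r := \sum_(t <- _) _ in phie xf.
have -> : y - iota (E y) = (y - cp_sum P f) + (iota (f 1%g - E y) + r).
  by rewrite xf rmorphB /= [iota _ - iota _ + r]addrAC addrA subrK.
rewrite (averagingD hphi (y - _)) (averagingD hphi (iota _)).
apply: le_lt_trans (ler_cnormD _ _) _.
have := ler_cnormD (phi (iota (f 1%g - E y))) (phi r).
have := cnorm_averaging hphi (y - cp_sum P f).
have := cnorm_averaging hphi (iota (f 1%g - E y)).
rewrite cnorm_iota cnorm_distC; have := cond_expP P y ff; lra.
Qed.

(** The closure of [E M] is a nonzero closed ideal of [A], invariant under
    [Lambda], so it contains [1]. If [E x] is close to [1] then so are the
    averages of [x] that are close to averages of [E x]. *)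
Lemma bimodule_near1 (Lambda : set G) (M : set B) : minimal_action alpha Lambda ->
  bimodule M -> (forall s x, Lambda s -> M x -> M (u s * x * u s^-1%g)) ->
  (exists2 y, M y & E y <> 0) ->
  forall e, 0 < e -> exists2 x, M x & cnorm (x - 1) < e.
Proof.
move=> minL bM ML [y My Ey] e e0; have [M0 MD Mll Mr] := bM.
pose I := norm_closure [set E x | x in M].
have idI : closed_ideal setT I.
  split=> //.
  - by move=> d d0; exists 0; rewrite ?subrr ?cnorm0 //; exists 0; rewrite ?cond_exp0.
  - move=> c a b Ia Ib d d0.
    have K1 : 0 < complex.Re `|c| + 1.
      by have := normr_ge0 c; case: `|c| => p q; rewrite lecE /= => /andP[_]; lra.
    have [_ [x Mx <-] hx] := Ia _ (divr_gt0 (divr_gt0 d0 (ltr0n R 2)) K1).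
    have [_ [z Mz <-] hz] := Ib _ (divr_gt0 d0 (ltr0n R 2)).
    exists (E (iota (c%:A) * x + z)); first by exists (iota c%:A * x + z) => //; apply: MD => //; exact: Mll.
    rewrite cond_expD cond_exp_mull -scalerAl mul1r opprD addrACA -scalerBr.
    apply: le_lt_trans (ler_cnormD _ _) _; rewrite cnormZ.
    have : (complex.Re `|c| + 1) * cnorm (a - E x) < d / 2.
      by rewrite mulrC -ltr_pdivlMr.
    have := cnorm_ge0 (a - E x); lra.
  - move=> d a _ Ia; have K1 : 0 < cnorm d + 1 by have := cnorm_ge0 d; lra.
    split=> r r0; have [_ [x Mx <-] hx] := Ia _ (divr_gt0 r0 K1).
      exists (d * E x); first by exists (iota d * x); [exact: Mll|rewrite cond_exp_mull].
      rewrite -mulrBr; apply: le_lt_trans (ler_cnormM _ _) _.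
      have : (cnorm d + 1) * cnorm (a - E x) < r by rewrite mulrC -ltr_pdivlMr.
      by have := cnorm_ge0 (a - E x); lra.
    exists (E x * d); first by exists (x * iota d); [exact: Mr|rewrite cond_exp_mulr].
    rewrite -mulrBl; apply: le_lt_trans (ler_cnormM _ _) _.
    have : (cnorm d + 1) * cnorm (a - E x) < r by rewrite mulrC -ltr_pdivlMr.
    by have := cnorm_ge0 (a - E x); lra.
  - move=> a Ia r r0; have r2 := divr_gt0 r0 (ltr0n R 2).
    have [b Ib ab] := Ia _ r2; have [c Mc bc] := Ib _ r2.
    by exists c => //; have := cnormB_trans b a c; lra.
have invI t : Lambda t -> alpha t @` I `<=` I.
  move=> Lt _ [a Ia <-] r r0; have [_ [x Mx <-] hx] := Ia _ r0.
  exists (alpha t (E x)); first by exists (u t * x * u t^-1%g); [exact: ML|rewrite cond_exp_conj].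
  by rewrite -raddfB /= cnorm_act.
have I1 : I 1.
  case: (minL I idI invI) => [I0|-> //]; case: Ey.
  have : I (E y) by move=> d d0; exists (E y); [exists y|rewrite subrr cnorm0].
  by rewrite I0.
have e2 := divr_gt0 e0 (ltr0n R 2).
have [_ [x Mx <-] hx] := I1 _ e2.
have [phi hphi hphix] := averaging_to_cond_exp x e2.
exists (phi x); first exact: averaging_bimodule hphi _ Mx.
have -> : phi x - 1 = phi (x - iota (E x)) + phi (iota (E x - 1)).
  rewrite -(averagingD hphi) rmorphB rmorph1 addrA subrK.
  by rewrite (averagingB _ _ hphi) (averaging1 hphi).
apply: le_lt_trans (ler_cnormD _ _) _.
have := cnorm_averaging hphi (iota (E x - 1)); rewrite cnorm_iota cnorm_distC; lra.
Qed.

End Averaging.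

(** * Intermediate C*-algebras *)

Section Subalgebras.
Variables (R : realType) (A : cstarAlgType R).
Implicit Types (S D I : set A) (x y : A).

Lemma norm_closed_closure S : norm_closed (norm_closure S).
Proof.
move=> x Sx e e0; have e2 := divr_gt0 e0 (ltr0n R 2).
have [y Sy xy] := Sx _ e2; have [z Sz yz] := Sy _ e2.
by exists z => //; have := cnormB_trans y x z; lra.
Qed.

Lemma sub_norm_closure S : S `<=` norm_closure S.
Proof. by move=> x Sx e e0; exists x; rewrite ?subrr ?cnorm0. Qed.

Lemma norm_closureS S D : S `<=` D -> norm_closure S `<=` norm_closure D.
Proof. by move=> SD x Sx e /Sx[y /SD Dy xy]; exists y. Qed.

Lemma cstar_subalgebra_smallest S : cstar_subalgebra (smallest (@cstar_subalgebra R A) S).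
Proof.
split.
- by move=> D [[D0 _ _ _ _] _].
- move=> c x y Sx Sy D HD; have [[_ DL _ _ _] _] := HD.
  by apply: DL; [exact: Sx|exact: Sy].
- move=> x y Sx Sy D HD; have [[_ _ DM _ _] _] := HD.
  by apply: DM; [exact: Sx|exact: Sy].
- by move=> x Sx D HD; have [[_ _ _ Ds _] _] := HD; apply: Ds; exact: Sx.
- move=> x Sx D HD; have [[_ _ _ _ Dc] _] := HD; apply: Dc.
  by apply: norm_closureS Sx => y; exact.
Qed.

Lemma cstar_subalgebra_closure S : S 0 ->
  (forall (c : R[i]) x y, S x -> S y -> S (c *: x + y)) ->
  (forall x y, S x -> S y -> S (x * y)) -> (forall x, S x -> S (star x)) ->
  cstar_subalgebra (norm_closure S).
Proof.
move=> S0 SL SM Ss; split.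
- exact: sub_norm_closure.
- move=> c x y Sx Sy e e0.
  have K1 : 0 < complex.Re `|c| + 1.
    by have := normr_ge0 c; case: `|c| => p q; rewrite lecE /= => /andP[_]; lra.
  have [x' Sx' hx] := Sx _ (divr_gt0 (divr_gt0 e0 (ltr0n R 2)) K1).
  have [y' Sy' hy] := Sy _ (divr_gt0 e0 (ltr0n R 2)).
  exists (c *: x' + y'); first exact: SL.
  rewrite opprD addrACA -scalerBr.
  apply: le_lt_trans (ler_cnormD _ _) _; rewrite cnormZ.
  have : (complex.Re `|c| + 1) * cnorm (x - x') < e / 2.
    by rewrite mulrC -ltr_pdivlMr.
  have := cnorm_ge0 (x - x'); lra.
- move=> x y Sx Sy e e0.
  have x0 := cnorm_ge0 x.
  have K1 : 0 < 2 * (cnorm x + 1) by lra.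
  have [y' Sy' hy] := Sy _ (divr_gt0 e0 K1).
  have K3 : 0 < 2 * (cnorm y' + 1) by have := cnorm_ge0 y'; lra.
  have [x' Sx' hx] := Sx _ (divr_gt0 e0 K3).
  exists (x' * y'); first exact: SM.
  have -> : x * y - x' * y' = x * (y - y') + (x - x') * y'.
    by rewrite mulrBr mulrBl addrA subrK.
  apply: le_lt_trans (ler_cnormD _ _) _.
  have := ler_cnormM x (y - y'); have := ler_cnormM (x - x') y'.
  have : (2 * (cnorm x + 1)) * cnorm (y - y') < e by rewrite mulrC -ltr_pdivlMr.
  have : (2 * (cnorm y' + 1)) * cnorm (x - x') < e by rewrite mulrC -ltr_pdivlMr.
  by have := cnorm_ge0 (x - x'); have := cnorm_ge0 (y - y'); lra.
- move=> x Sx e /Sx[y Sy xy]; exists (star y); first exact: Ss.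
  by rewrite -starB cnorm_star.
- exact: norm_closed_closure.
Qed.

Lemma cstar_subalgebra_add D x y : cstar_subalgebra D -> D x -> D y -> D (x + y).
Proof. by move=> [_ DL _ _ _] Dx Dy; rewrite -[x]scale1r; exact: DL. Qed.

Lemma cstar_subalgebra_sum D (I : eqType) (s : seq I) (F : I -> A) :
  cstar_subalgebra D -> (forall i, i \in s -> D (F i)) -> D (\sum_(i <- s) F i).
Proof.
move=> sD; elim: s => [|i s IH] HF; first by rewrite big_nil; case: sD.
rewrite big_cons; apply: cstar_subalgebra_add => //; first exact/HF/mem_head.
by apply: IH => j js; apply: HF; rewrite inE js orbT.
Qed.

End Subalgebras.

Section SubCrossedProducts.
Variables (R : realType) (G : groupType) (A : cstarAlgType R).
Variables (alpha : star_action G A) (H : hilbertType R) (rho : faithful_rep A H).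
Variables (B : cstarAlgType R) (P : reduced_crossed_product alpha rho B).
Implicit Types (f g : G -> A) (T : seq G) (a b v : A) (x y z : B) (U : set G).

Local Notation iota := (rcp_iota P).
Local Notation u := (rcp_u P).
Local Notation E := (cond_exp P).
Local Notation scp := (sub_crossed_product P).

Lemma scp_subalgebra U : cstar_subalgebra (scp U).
Proof. exact: cstar_subalgebra_smallest. Qed.

Lemma scp_iota U a : scp U (iota a).
Proof. by apply: sub_gen_smallest; left; exists a. Qed.

Lemma scp_u U t : U t -> scp U (u t).
Proof. by move=> Ut; apply: sub_gen_smallest; right; exists t. Qed.

Lemma scp_min U D : cstar_subalgebra D -> (forall a, D (iota a)) ->
  (forall t, U t -> D (u t)) -> scp U `<=` D.
Proof.
move=> sD Da Du; apply: smallest_sub => // _ [[a _ <-]|[t Ut <-]];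
  [exact: Da|exact: Du].
Qed.

Lemma scpS U V : U `<=` V -> scp U `<=` scp V.
Proof.
move=> UV; apply: scp_min; [exact: scp_subalgebra|exact: scp_iota|].
by move=> t /UV; exact: scp_u.
Qed.

Lemma scp_cp_sum U f : finsupp_fun f -> (forall t, ~ U t -> f t = 0) ->
  scp U (cp_sum P f).
Proof.
move=> /finsuppP[T uT fT] fU; rewrite (cp_sumE P uT fT).
apply: cstar_subalgebra_sum => [|t _]; first exact: scp_subalgebra.
have [Ut|/fU ->] := pselect (U t); last first.
  by rewrite rmorph0 mul0r; case: (scp_subalgebra U).
have [_ _ DM _ _] := scp_subalgebra U.
by apply: DM; [exact: scp_iota|exact: scp_u].
Qed.

Definition cp_sums U : set B :=
  [set cp_sum P f | f in [set f | finsupp_fun f /\ forall t, ~ U t -> f t = 0]].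

Lemma cp_sums0 U : cp_sums U 0.
Proof.
exists (fun=> 0); first by split=> //; exact: finsupp0.
by rewrite (@cp_sumE _ _ _ _ _ _ _ P _ [::]) // big_nil.
Qed.

Lemma cp_sumsD U x y : cp_sums U x -> cp_sums U y -> cp_sums U (x + y).
Proof.
move=> [f [ff fU] <-] [g [gf gU] <-]; exists (fun t => f t + g t).
  by split=> [|t Ut]; [exact: finsupp_add|rewrite fU // gU // addr0].
exact: cp_sumD.
Qed.

Lemma cp_sums_monomial U a t : U t -> cp_sums U (iota a * u t).
Proof.
move=> Ut; exists (single t a); last exact: cp_sum_single.
split=> [|s Us]; first exact: finsupp_single.
by rewrite /single; case: eqP => // st; rewrite st in Us.
Qed.

Lemma cp_sums_ind U (Q : B -> Prop) : Q 0 ->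
  (forall x y, Q x -> Q y -> Q (x + y)) ->
  (forall a t, U t -> Q (iota a * u t)) -> forall x, cp_sums U x -> Q x.
Proof.
move=> Q0 QD Qm _ [f [/finsuppP[T uT fT] fU] <-]; rewrite (cp_sumE P uT fT).
apply: big_ind => // t _; have [/Qm//|/fU ->] := pselect (U t).
by rewrite rmorph0 mul0r.
Qed.

Lemma cp_sums_closure_subalgebra U : subgroup U ->
  cstar_subalgebra (norm_closure (cp_sums U)).
Proof.
move=> sU; have UM s t : U s -> U t -> U (s * t)%g.
  move=> /mem_set Us /mem_set Ut; apply/set_mem.
  exact: (group_closedM sU).
have UV t : U t -> U t^-1%g.
  by move=> /mem_set Ut; apply/set_mem; exact: (group_closedV sU).
apply: cstar_subalgebra_closure; first exact: cp_sums0.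
- move=> c x y Ux Uy; apply: cp_sumsD => //.
  move: x Ux; apply: cp_sums_ind => [|x z Ux Uz|a t Ut].
  + by rewrite scaler0; exact: cp_sums0.
  + by rewrite scalerDr; exact: cp_sumsD.
  + by rewrite scalerAl -linearZ; exact: cp_sums_monomial.
- move=> x y Ux Uy; move: x Ux; apply: cp_sums_ind => [|x z Ux Uz|a s Us].
  + by rewrite mul0r; exact: cp_sums0.
  + by rewrite mulrDl; exact: cp_sumsD.
  + move: y Uy; apply: cp_sums_ind => [|x z Ux Uz|b t Ut].
    * by rewrite mulr0; exact: cp_sums0.
    * by rewrite mulrDr; exact: cp_sumsD.
    * rewrite mulrA -[_ * iota b]mulrA rcp_comm mulrA -rmorphM -mulrA -rcp_uM.
      exact/cp_sums_monomial/UM.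
- move=> x Ux; move: x Ux; apply: cp_sums_ind => [|x z Ux Uz|a s Us].
  + by rewrite star0; exact: cp_sums0.
  + by rewrite starD; exact: cp_sumsD.
  + rewrite starM star_rcp_u -rcp_iota_star rcp_comm.
    exact/cp_sums_monomial/UV.
Qed.

(** The crossed product by [U] lies in the closure of the finite sums over [U],
    and coefficients are continuous. *)
Lemma scp_coef_eq0 U x t : subgroup U -> scp U x -> ~ U t -> E (x * u t^-1%g) = 0.
Proof.
move=> sU Ux Ut; have : norm_closure (cp_sums U) x.
  apply: scp_min Ux; first exact: cp_sums_closure_subalgebra.
    move=> a; apply: sub_norm_closure; rewrite -[iota a]mulr1 -(rcp_u1 P).
    by apply: cp_sums_monomial; apply/set_mem; case: sU.
  move=> s Us; apply: sub_norm_closure; rewrite -[u s]mul1r -(rmorph1 iota).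
  exact: cp_sums_monomial.
move=> Cx; apply: cnorm_small => e /Cx[_ [f [ff fU] <-] xf].
by rewrite -[E _]subr0 -(fU t Ut) (le_trans (coef_dist P x t ff)) // ltW.
Qed.

(** An element with coefficients supported in [U] has the same coefficients as
    its conditional expectation onto the crossed product by [U]. *)
Lemma scp_of_coef U x : subgroup U -> (forall t, ~ U t -> E (x * u t^-1%g) = 0) ->
  scp U x.
Proof.
move=> sU xU; have [z Hz] := cond_exp_subgroup_exists P sU x.
have rU f t : ~ U t -> restrict U f t = 0.
  by move=> Ut; rewrite /restrict ifF //; apply/negP => /set_mem.
have -> : x = z.
  apply/eqP; rewrite -subr_eq0; apply/eqP; apply: (@coef_eq0 _ _ _ _ _ _ _ P) => t.
  apply: cnorm_small => e e0; have e2 := divr_gt0 e0 (ltr0n R 2).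
  have [f ff xf] := cp_sum_dense P x e2.
  have h1 := coef_dist P x t ff.
  have h2 := coef_dist P z t (finsupp_restrict U ff).
  have h3 := Hz f ff.
  rewrite mulrBl cond_expB.
  have [Ut|Ut] := pselect (U t).
    have ft : restrict U f t = f t by rewrite /restrict ifT //; exact: mem_set.
    rewrite ft in h2; have := cnormB_trans (f t) (E (x * u t^-1%g)) (E (z * u t^-1%g)).
    rewrite [cnorm (f t - _)]cnorm_distC; lra.
  by rewrite xU // sub0r cnormN; rewrite rU // subr0 in h2; lra.
have [_ _ _ _] := scp_subalgebra U; apply=> e e0.
have [f ff xf] := cp_sum_dense P x e0.
exists (cp_sum P (restrict U f)); last exact: le_lt_trans (Hz f ff) xf.
by apply: scp_cp_sum; [exact: finsupp_restrict|exact: rU].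
Qed.

Lemma scp_u_inv U t : subgroup U -> scp U (u t) -> U t.
Proof.
move=> sU Ut; apply: contrapT => nUt; have := scp_coef_eq0 sU Ut nUt.
rewrite -rcp_uM mulgV rcp_u1 -(rmorph1 iota) cond_exp_iota => /eqP.
by rewrite oner_eq0.
Qed.

Section Intermediate.
Hypothesis save : SAveP_action alpha.
Variable Lambda : set G.
Hypotheses (minL : minimal_action alpha Lambda) (sL : subgroup Lambda).

(** A nonzero ideal of [D] is an [A]-bimodule on which [E] does not vanish, because
    [E] is faithful; hence it comes arbitrarily close to [1]. *)
Lemma intermediate_simple D : cstar_subalgebra D -> scp Lambda `<=` D ->
  cstar_simple D.
Proof.
move=> sD LD; have Da a : D (iota a) by apply: LD; exact: scp_iota.
have Du t : Lambda t -> D (u t) by move=> Lt; apply: LD; exact: scp_u.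
have D1 : D 1 by rewrite -(rmorph1 iota); exact: Da.
split=> [D0|I [ID I0 IL IM Ic]].
  have : [set 0] (1 : B) by rewrite -D0.
  by move=> /= /eqP; rewrite oner_eq0.
have [[y Iy y0]|nI] := pselect (exists2 y, I y & y <> 0); last first.
  left; apply/seteqP; split=> [x Ix|_ ->//]; apply: contrapT => x0.
  by apply: nI; exists x.
right; apply/seteqP; split=> // d Dd.
suff I1 : I 1 by have [+ _] := IM _ _ Dd I1; rewrite mulr1.
apply: Ic => e e0; have [|||x Ix x1] := @bimodule_near1 _ _ _ _ _ _ _ P save _ I minL _ _ _ e e0.
- split=> // [x z Ix Iz|a x Ix|a x Ix].
  + by rewrite -[x]scale1r; exact: IL.
  + by have [] := IM _ _ (Da a) Ix.
  + by have [] := IM _ _ (Da a) Ix.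
- move=> s x Ls Ix; have Us := Du _ Ls.
  have Us' : D (u s^-1%g).
    by rewrite -star_rcp_u; case: sD => _ _ _ Ds _; exact: Ds.
  by have [/(IM _ _ Us')[]] := IM _ _ Us Ix.
- exists (star y * y); last by move=> /cond_exp_faithful.
  have [_ _ _ Ds _] := sD.
  by have [] := IM _ _ (Ds _ (ID _ Iy)) Iy.
- by exists x => //; rewrite cnorm_distC.
Qed.

(** Normality of [Lambda] makes [D u_t^*] stable under conjugation by [u_s] for [s]
    in [Lambda]. It is an [A]-bimodule on which [E] does not vanish, so it comes
    close to [1], which means that [D] comes close to [u_t]. *)
Lemma intermediate_has_unitary D y t : normal_subgroup Lambda ->
  cstar_subalgebra D -> scp Lambda `<=` D -> D y -> E (y * u t^-1%g) <> 0 ->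
  D (u t).
Proof.
move=> [_ nL] sD LD Dy Ey; have Da a : D (iota a) by apply: LD; exact: scp_iota.
have Du s : Lambda s -> D (u s) by move=> Ls; apply: LD; exact: scp_u.
have [D0 _ DM Ds Dc] := sD.
apply: Dc => e e0.
have [|||x Dx x1] :=
  @bimodule_near1 _ _ _ _ _ _ _ P save _ [set x | D (x * u t)] minL _ _ _ e e0.
- split=> [|x z /= Dx Dz|a x /= Dx|a x /= Dx] /=.
  + by rewrite mul0r.
  + by rewrite mulrDl; exact: cstar_subalgebra_add.
  + by rewrite -mulrA; exact: DM.
  + have -> : x * iota a * u t = x * u t * iota (alpha t^-1%g a).
      by rewrite -!mulrA rcp_comm -actM mulgV act1.
    exact: DM.
- move=> s x Ls /= Dx.
  have -> : u s * x * u s^-1%g * u t = u s * (x * u t) * u (t^-1 * s^-1 * t)%g.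
    by rewrite -!mulrA -!rcp_uM !mulgA mulgV mul1g.
  apply: (DM); first by apply: (DM) => //; exact: (Du).
  apply: Du; have := nL s^-1%g t^-1%g; rewrite invgK; apply.
  by move: Ls => /mem_set Ls; apply/set_mem; exact: (group_closedV sL).
- by exists (y * u t^-1%g) => //=; rewrite rcp_uKV.
- exists (x * u t) => //.
  rewrite -{1}[u t]mul1r -mulrBl; apply: le_lt_trans (ler_cnormM _ _) _.
  by rewrite cnorm_rcp_u mulr1 cnorm_distC.
Qed.

Lemma intermediate_eq_scp D : normal_subgroup Lambda ->
  cstar_subalgebra D -> scp Lambda `<=` D ->
  exists2 U, subgroup U /\ Lambda `<=` U & scp U = D.
Proof.
move=> nL sD LD; have Da a : D (iota a) by apply: LD; exact: scp_iota.
have [_ _ DM Ds _] := sD.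
exists [set t | D (u t)].
  split; last by move=> t Lt; apply: LD; exact: scp_u.
  split=> [|s t /set_mem/= Us /set_mem/= Ut]; apply/mem_set => /=.
    by rewrite rcp_u1 -(rmorph1 iota); exact: Da.
  by rewrite rcp_uM -star_rcp_u; apply: DM => //; exact: Ds.
have sU : subgroup [set t | D (u t)].
  split=> [|s t /set_mem/= Us /set_mem/= Ut]; apply/mem_set => /=.
    by rewrite rcp_u1 -(rmorph1 iota); exact: Da.
  by rewrite rcp_uM -star_rcp_u; apply: DM => //; exact: Ds.
apply/seteqP; split; first exact: scp_min.
move=> y Dy; apply: scp_of_coef => // t Ut; apply: contrapT => Ey; apply: Ut.
exact: intermediate_has_unitary Ey.
Qed.

End Intermediate.
End SubCrossedProducts.

Theorem theorem3p4 (R : realType) (Gamma : groupType) (A : cstarAlgType R)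
    (alpha : star_action Gamma A)
    (H : hilbertType R) (rho : faithful_rep A H)
    (AxG : cstarAlgType R) (P : reduced_crossed_product alpha rho AxG)
    (Lambda : set Gamma) :
  SAveP_action alpha -> subgroup Lambda -> minimal_action alpha Lambda ->
  cstar_irreducible (sub_crossed_product P Lambda)
                    (sub_crossed_product P [set: Gamma]) /\
  (normal_subgroup Lambda ->
   set_bij
     [set Upsilon : set Gamma | subgroup Upsilon /\ Lambda `<=` Upsilon]
     [set D : set AxG | [/\ cstar_subalgebra D,
                            sub_crossed_product P Lambda `<=` D &
                            D `<=` sub_crossed_product P [set: Gamma]]]
     (sub_crossed_product P)).
Proof.
move=> save sL minL; split.
  split; [exact: scp_subalgebra|exact: scp_subalgebra| |exact: scpS|].
    by rewrite -(rmorph1 (rcp_iota P)); exact: scp_iota.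
  by move=> D sD LD _; exact: intermediate_simple LD.
move=> nL; split.
- move=> U [sU LU]; split; [exact: scp_subalgebra|exact: scpS|exact: scpS].
- have incl U V : subgroup V -> sub_crossed_product P U = sub_crossed_product P V ->
      U `<=` V.
    by move=> sV UV t Ut; apply: (scp_u_inv (P := P) sV); rewrite -UV; exact: scp_u.
  move=> U V /set_mem[sU _] /set_mem[sV _] UV.
  by apply/seteqP; split; apply: incl.
- move=> D [sD LD _].
  by have [U sU <-] := intermediate_eq_scp save minL sL nL sD LD; exists U.
Qed.
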